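(* There exist an absolute constant $C\ge 1$ and a randomized algorithm that, given query access to two functions $f,g\colon\{-1,1\}^n\to\{-1,1\}$ and a parameter $\epsilon\in(0,1)$, satisfies the following. (1) If $f$ and $g$ are $\frac{\epsilon}{C}$-close to isomorphic, then the algorithm accepts with high constant probability (at least $2/3$). (2) If $f$ and $g$ are $\epsilon$-far from isomorphic, then the algorithm rejects with high constant probability (at least $2/3$). The query complexity of the algorithm is $\tilde O\big(2^{k^*/2}/\epsilon\big)$ with high (constant, at least $2/3$) probability, and $\tilde O\big(2^{n/2}/\epsilon\big)$ in the worst case, where $k^*=k^*(f,g,\frac{\epsilon}{C})$ (which is not given to the algorithm).
   Context: $\mathrm{dist}(f,g)=\Pr_x[f(x)\ne g(x)]$ with $x$ uniform in $\{-1,1\}^n$. For a permutation $\pi$ of $[n]$, $g\circ\pi$ is the function obtained from $g$ by relabeling its input variables according to $\pi$. Let $\mathrm{distiso}(f,g)=\min_{\pi\in\mathcal S_n}\mathrm{dist}(f,g\circ\pi)$; $f$ and $g$ are $\gamma$-close to isomorphic if $\mathrm{distiso}(f,g)\le\gamma$ and $\gamma$-far from isomorphic if $\mathrm{distiso}(f,g)>\gamma$. A $k$-junta is a Boolean function depending on at most $k$ of its variables. For $\gamma\in[0,1]$, $k^*(f,g,\gamma)$ is the smallest $k$ such that at least one of $f,g$ is at distance at most $\gamma$ from some $k$-junta. $\tilde O(F)$ means $O(F\log^c (F+2))$ for some absolute constant $c$, with absolute implied constants. Query complexity is the number of points of $\{-1,1\}^n$ on which the algorithm requests the value of $f$ or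 of $g$. *)

(* Defs.v *)
From HB Require Import structures.
From mathcomp Require Import all_boot all_order all_algebra all_fingroup.
From mathcomp Require Import reals exp.

Set Implicit Arguments.
Unset Strict Implicit.
Unset Printing Implicit Defensive.

Import Order.TTheory GRing.Theory Num.Theory.

Local Open Scope ring_scope.

(* The set {-1, 1} is encoded by bool (b stands for (-1)^b); only equality of
   values is ever used. *)
Definition cube (n : nat) := {ffun 'I_n -> bool}.
Definition boolfun (n : nat) := {ffun cube n -> bool}.

Section Distances.
Variables (R : realType) (n : nat).
Implicit Types f g h : boolfun n.

Definition dist f g : R :=
  #|[set x : cube n | f x != g x]|%:R / #|{: cube n}|%:R.

Definition relabel g (pi : {perm 'I_n}) : boolfun n :=
  [ffun x : cube n => g [ffun i => x (pi i)]].

(* The initial value [dist f g] is the term of the identity permutation, so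
   this is the minimum of the [dist f (relabel g pi)]. *)
Definition distiso f g : R :=
  \big[Num.min/dist f g]_(pi : {perm 'I_n}) dist f (relabel g pi).

Definition close_to_iso (gamma : R) f g : Prop := distiso f g <= gamma.
Definition far_from_iso (gamma : R) f g : Prop := distiso f g > gamma.

Definition depends_on f (i : 'I_n) : bool :=
  [exists x : cube n, exists y : cube n,
     [forall j : 'I_n, (j != i) ==> (x j == y j)] && (f x != f y)].

Definition junta (k : nat) f : bool := (#|[set i | depends_on f i]| <= k)%N.

Definition close_to_junta (gamma : R) (k : nat) f : bool :=
  [exists h : boolfun n, junta k h && (dist f h <= gamma)].

(* Every function on n variables is an n-junta, so for gamma >= 0 the minimum
   over k <= n is the minimum over all k; see [kstarP]. *)
Definition kstar f g (gamma : R) : nat :=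
  [arg min_(k < (ord_max : 'I_n.+1)
      | close_to_junta gamma k f || close_to_junta gamma k g) (k : nat)].

Lemma dist_refl f : dist f f = 0.
Proof.
rewrite /dist (_ : [set x | _] = set0) ?cards0 ?mul0r//.
by apply/setP => x; rewrite !inE eqxx.
Qed.

Lemma relabel1 g : relabel g 1%g = g.
Proof.
apply/ffunP => x; rewrite ffunE; congr (g _).
by apply/ffunP => i; rewrite ffunE perm1.
Qed.

Lemma distiso_le f g (pi : {perm 'I_n}) : distiso f g <= dist f (relabel g pi).
Proof. by rewrite /distiso (bigD1 pi)//= ge_min lexx. Qed.

Lemma distiso_attained f g :
  exists pi : {perm 'I_n}, distiso f g = dist f (relabel g pi).
Proof.
rewrite /distiso; elim/big_ind: _ => [|a b [p ->] [q ->]|p _].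
- by exists 1%g; rewrite relabel1.
- by rewrite minEle; case: ifP => _; [exists p | exists q].
- by exists p.
Qed.

Lemma kstarP f g (gamma : R) : 0 <= gamma ->
  (close_to_junta gamma (kstar f g gamma) f
     || close_to_junta gamma (kstar f g gamma) g) /\
  forall k : nat, close_to_junta gamma k f || close_to_junta gamma k g ->
    (kstar f g gamma <= k)%N.
Proof.
move=> gamma0; rewrite /kstar; case: arg_minnP => [|i Pi imin].
  apply/orP; left; apply/existsP; exists f.
  rewrite dist_refl gamma0 andbT /junta.
  by rewrite (leq_trans (max_card _)) ?card_ord.
split=> // k Pk; case: (ltnP k n.+1) => [kn|nk].
  exact: imin (Ordinal kn) Pk.
by rewrite ltnW// (leq_trans (ltn_ord i)).
Qed.

End Distances.

(* Deterministic query algorithms on inputs (f, g), i.e. decision trees. *)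
Inductive dtree (n : nat) : Type :=
| Answer of bool
| QueryF of cube n & (bool -> dtree n)
| QueryG of cube n & (bool -> dtree n).

Arguments Answer {n}.

Fixpoint accepts n (t : dtree n) (f g : boolfun n) : bool :=
  match t with
  | Answer b => b
  | QueryF x next => accepts (next (f x)) f g
  | QueryG x next => accepts (next (g x)) f g
  end.

Fixpoint queries n (t : dtree n) (f g : boolfun n) : nat :=
  match t with
  | Answer _ => 0
  | QueryF x next => (queries (next (f x)) f g).+1
  | QueryG x next => (queries (next (g x)) f g).+1
  end.

(* A randomized query algorithm is a finitely supported probability
   distribution over deterministic ones. *)
Record randalg (R : realType) (n : nat) := RandAlg {
  coins : finType;
  weight : coins -> R;
  weight_ge0 : forall w, 0 <= weight w;
  weight_sum1 : \sum_w weight w = 1;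
  strategy : coins -> dtree n
}.

Definition Prob (R : realType) (n : nat) (A : randalg R n)
  (E : pred (dtree n)) : R := \sum_(w : coins A | E (strategy w)) weight w.

Definition softO (R : realType) (K : R) (c : nat) (F : R) : R :=
  K * (F * ln (F + 2) ^+ c).

(* Main.v *)
Require Import Defs.
From mathcomp Require Import all_boot all_order all_algebra all_fingroup.
From mathcomp Require Import reals exp.
From mathcomp Require Import ring lra zify.

Set Implicit Arguments.
Unset Strict Implicit.
Unset Printing Implicit Defensive.

Import Order.TTheory GRing.Theory Num.Theory.
Local Open Scope ring_scope.

(* Write infl u J for the probability that u changes when the variables outside
   J are resampled; by Fourier analysis it is the weight of the sets T not
   contained in J for some nonnegative weights on sets, and up to a factor 2 it
   is the distance from u to the functions of the variables in J.

   Junta test. Bin the variables at random. Select each bin with probability 3/4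
   and resample the unselected ones: conditioned on k given bins being selected,
   the probability of a change is within a constant factor of the influence
   outside these bins, so about (4/3)^k <= 2^(k/2) samples, up to factors 1/eps
   and poly(k), serve all k-subsets of bins at once. If u is far from k-juntas,
   then no k bins capture it, except with probability poly(k) / #bins.

   Isomorphism test, once both functions are known to be close to k-juntas. Give
   all variables of a bin the same random bit, xored with a fixed random shift of
   the cube. About 2^(k/2)/eps such points for f and for g contain enough pairs
   with equal values on k bins of f and k bins of g to estimate, by Chebyshev, the
   disagreement of the two juntas under each matching of the bins.

   The tester runs the junta test for k = 0, 1, ... with summable error
   probabilities until f or g passes, and then decides by the isomorphism test.
   As the latter uses fresh randomness, it is only charged once. *)

(** * Finite probability *)

Section Expectation.
Variable R : realType.

Definition Ex (T : finType) (F : T -> R) : R := (\sum_x F x) / #|T|%:R.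

Lemma eq_Ex (T : finType) (F G : T -> R) : F =1 G -> Ex F = Ex G.
Proof. by move=> FG; rewrite /Ex (eq_bigr _ (fun x _ => FG x)). Qed.

Lemma ExD (T : finType) (F G : T -> R) :
  Ex (fun x => F x + G x) = Ex F + Ex G.
Proof. by rewrite /Ex big_split mulrDl. Qed.

Lemma ExZ (T : finType) (a : R) (F : T -> R) :
  Ex (fun x => a * F x) = a * Ex F.
Proof. by rewrite /Ex -mulr_sumr mulrA. Qed.

Lemma ExZr (T : finType) (a : R) (F : T -> R) :
  Ex (fun x => F x * a) = Ex F * a.
Proof. by rewrite mulrC -ExZ; apply: eq_Ex => x; rewrite mulrC. Qed.

Lemma ExB (T : finType) (F G : T -> R) :
  Ex (fun x => F x - G x) = Ex F - Ex G.
Proof. by rewrite /Ex sumrB mulrBl. Qed.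

Lemma Ex_sum (T I : finType) (P : pred I) (F : I -> T -> R) :
  Ex (fun x => \sum_(i | P i) F i x) = \sum_(i | P i) Ex (F i).
Proof. by rewrite /Ex exchange_big mulr_suml. Qed.

Lemma le_Ex (T : finType) (F G : T -> R) :
  (forall x, F x <= G x) -> Ex F <= Ex G.
Proof. by move=> FG; rewrite ler_wpM2r ?invr_ge0 ?ler_sum. Qed.

Lemma Ex_cst (T : finType) (a : R) : (0 < #|T|)%N -> Ex (fun _ : T => a) = a.
Proof.
move=> T0; rewrite /Ex sumr_const -[a *+ _]mulr_natr -mulrA divff ?mulr1 //.
by rewrite pnatr_eq0 -lt0n.
Qed.

Lemma Ex_ge0 (T : finType) (F : T -> R) : (forall x, 0 <= F x) -> 0 <= Ex F.
Proof. by move=> F0; rewrite divr_ge0 ?sumr_ge0. Qed.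

Lemma Ex_pair (T U : finType) (F : T * U -> R) :
  Ex F = Ex (fun x => Ex (fun y => F (x, y))).
Proof.
rewrite /Ex -mulr_suml pair_big /= card_prod natrM invfM -mulrA.
by rewrite [X in _ = _ * X]mulrC; congr (_ * _); apply: eq_bigr => -[].
Qed.

Lemma Ex_swap (T U : finType) (F : T -> U -> R) :
  Ex (fun x => Ex (F x)) = Ex (fun y => Ex (F^~ y)).
Proof.
rewrite /Ex -!mulr_suml exchange_big /= -!mulrA; congr (_ * _); exact: mulrC.
Qed.

Lemma Ex_bij (T U : finType) (h : T -> U) (F : U -> R) :
  bijective h -> Ex (fun x => F (h x)) = Ex F.
Proof.
move=> hb; rewrite /Ex (bij_eq_card hb); congr (_ / _).
by rewrite [RHS](reindex h) //; exact: onW_bij.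
Qed.

Lemma exists_le_Ex (T : finType) (F : T -> R) (a : R) : (0 < #|T|)%N ->
  Ex F <= a -> exists x, F x <= a.
Proof.
move=> T0 Fa; apply/existsP; apply: contraTT Fa.
rewrite negb_exists => /forallP H; rewrite -ltNge -[ltLHS](@Ex_cst T) //.
rewrite ltr_pM2r ?invr_gt0 ?ltr0n //; apply: ltr_sum => [|x _].
  by case/card_gt0P: T0 => x _; apply/hasP; exists x; rewrite ?mem_index_enum.
by rewrite ltNge.
Qed.

Definition pr (T : finType) (P : pred T) : R := Ex (fun x => (P x)%:R).

Lemma prE (T : finType) (P : pred T) : pr P = #|[set x | P x]|%:R / #|T|%:R.
Proof.
rewrite /pr /Ex -natr_sum -sum1_card; congr (_%:R / _).
by rewrite [RHS]big_mkcond; apply: eq_bigr => x _; rewrite inE; case: (P x).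
Qed.

Lemma pr_ge0 (T : finType) (P : pred T) : 0 <= pr P.
Proof. exact: Ex_ge0. Qed.

Lemma le_pr (T : finType) (P Q : pred T) :
  (forall x, P x -> Q x) -> pr P <= pr Q.
Proof.
move=> PQ; apply: le_Ex => x; rewrite ler_nat.
by case: (P x) (PQ x) => // ->.
Qed.

Lemma pr_le1 (T : finType) (P : pred T) : pr P <= 1.
Proof.
have [T0|] := posnP #|T|; first by rewrite /pr /Ex T0 invr0 mulr0.
by move=> T0; rewrite -(Ex_cst 1 T0); apply: le_Ex => x; rewrite lern1 leq_b1.
Qed.

Lemma prC (T : finType) (P : pred T) : (0 < #|T|)%N ->
  pr (fun x => ~~ P x) = 1 - pr P.
Proof.
move=> T0; rewrite -(Ex_cst 1 T0) -ExB; apply: eq_Ex => x.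
by case: (P x); rewrite ?subrr ?subr0.
Qed.

Lemma prU (T : finType) (P Q : pred T) :
  pr (fun x => P x || Q x) <= pr P + pr Q.
Proof.
rewrite -ExD; apply: le_Ex => x; rewrite -natrD ler_nat.
by case: (P x); case: (Q x).
Qed.

Lemma pr_exists (T I : finType) (P : I -> pred T) :
  pr (fun x => [exists i, P i x]) <= \sum_i pr (P i).
Proof.
rewrite -Ex_sum; apply: le_Ex => x; rewrite -natr_sum ler_nat.
by case: existsP => // -[i Pi]; rewrite (bigD1 i) //= Pi.
Qed.

Lemma markov (T : finType) (F : T -> R) (a : R) : (forall x, 0 <= F x) ->
  0 < a -> pr (fun x => a <= F x) <= Ex F / a.
Proof.
move=> F0 a0; rewrite ler_pdivlMr // mulrC -ExZ; apply: le_Ex => x.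
by case: (leP a (F x)) => aF; rewrite ?mulr1 ?mulr0.
Qed.

Section Product.
Variables (I T : finType).

Lemma Ex_prod (F : I -> T -> R) :
  Ex (fun w : {ffun I -> T} => \prod_i F i (w i)) = \prod_i Ex (F i).
Proof.
rewrite /Ex big_split /= prodr_const bigA_distr_bigA /=.
by rewrite card_ffun natrX exprVn.
Qed.

Hypothesis T0 : (0 < #|T|)%N.

Lemma card_ffun_gt0 : (0 < #|{ffun I -> T}|)%N.
Proof. by rewrite card_ffun expn_gt0 T0. Qed.

Lemma Ex_coord (i : I) (F : T -> R) :
  Ex (fun w : {ffun I -> T} => F (w i)) = Ex F.
Proof.
have := Ex_prod (fun j => if j == i then F else fun=> 1).
rewrite (bigD1 i) //= eqxx big1 ?mulr1 => [<-|j /negPf->]; last exact: Ex_cst.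
apply: eq_Ex => w; rewrite (bigD1 i) //= eqxx big1 ?mulr1 // => j /negPf-> //.
Qed.

Lemma Ex_coord2M (i j : I) (F G : T -> R) : i != j ->
  Ex (fun w : {ffun I -> T} => F (w i) * G (w j)) = Ex F * Ex G.
Proof.
rewrite eq_sym => ji; have jiF := negPf ji.
have := Ex_prod (fun l => if l == i then F else if l == j then G else fun=> 1).
rewrite (bigD1 i) //= eqxx (bigD1 j) //= jiF eqxx.
rewrite big1 ?mulr1 => [<-|l /andP[/negPf-> /negPf->]]; last exact: Ex_cst.
apply: eq_Ex => w; rewrite (bigD1 i) //= eqxx (bigD1 j) //= jiF eqxx.
by rewrite big1 ?mulr1 // => l /andP[/negPf-> /negPf->].
Qed.

Lemma Ex_coord2 (i j : I) (H : T -> T -> R) : i != j ->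
  Ex (fun w : {ffun I -> T} => H (w i) (w j)) = Ex (fun x => Ex (H x)).
Proof.
move=> ij.
(* Expanding in the indicators of the first coordinate turns a function of two coordinates into a
   sum of products, for which independence is known. *)
have delta (x : T) (F : T -> R) : F x = \sum_a (x == a)%:R * F a.
  rewrite (bigD1 x) //= eqxx mul1r big1 ?addr0 // => a /negPf ax.
  by rewrite eq_sym ax mul0r.
rewrite (eq_Ex (fun w : {ffun I -> T} => delta (w i) (fun a => H a (w j)))).
rewrite Ex_sum.
rewrite (eq_Ex (fun x => delta x (fun a => Ex (H a)))) Ex_sum.
apply: eq_bigr => a _; rewrite ExZr.
by rewrite (@Ex_coord2M i j (fun x => (x == a)%:R) (H a)).
Qed.

End Product.

(* Exponential moment: 16 ^ #bad >= 4 ^ R on the event, and each coordinate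
   contributes 1 + 15 Pr[bad] <= 2. *)
Lemma majority (T : finType) (r : nat) (bad : pred T) : (0 < #|T|)%N ->
  pr bad <= 20^-1 ->
  pr (fun w : {ffun 'I_r -> T} => (r <= 2 * #|[set i | bad (w i)]|)%N)
    <= 2^-1 ^+ r.
Proof.
move=> T0 bad20.
pose F (x : T) : R := if bad x then 16 else 1.
have EF : Ex F <= 2.
  have -> : Ex F = 1 + 15 * pr bad.
    rewrite -[X in X + _](Ex_cst 1 T0) -ExZ -ExD; apply: eq_Ex => x.
    by rewrite /F; case: (bad x) => /=; ring.
  lra.
have EF0 : 0 <= Ex F by apply: Ex_ge0 => x; rewrite /F; case: (bad x).
apply: (@le_trans _ _ (4^-1 ^+ r * \prod_(i < r) Ex F)); last first.
  rewrite prodr_const card_ord -exprMn; apply: lerXn2r; rewrite ?nnegrE; lra.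
have := Ex_prod (fun _ : 'I_r => F); rewrite /= => <-.
rewrite -ExZ; apply: le_Ex => w.
have -> : \prod_i F (w i) = 4 ^+ (2 * #|[set i | bad (w i)]|).
  rewrite exprM (_ : 4 ^+ 2 = 16 :> R); last by rewrite -natrX.
  rewrite -prodr_const [RHS]big_mkcond /=; apply: eq_bigr => i _.
  by rewrite inE /F; case: ifP.
case: leqP => [le_r|_]; last by rewrite mulr_ge0 // ?exprn_ge0 // ?invr_ge0.
by rewrite exprVn ler_pdivlMl ?exprn_gt0 // mulr1 ler_weXn2l // ler1n.
Qed.

End Expectation.

(** * Influences *)

Section Influence.
Variables (R : realType) (n : nat).
Implicit Types (u h : boolfun n) (x y : cube n) (J T : {set 'I_n}).

Definition mix J x y : cube n := [ffun i => if i \in J then x i else y i].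

(* The influence of the complement of J. *)
Definition infl u J : R :=
  Ex (fun x => Ex (fun y => (u x != u (mix J x y))%:R)).

Lemma cube_gt0 : (0 < #|{: cube n}|)%N.
Proof. by apply: card_ffun_gt0; rewrite card_bool. Qed.

Definition sg (b : bool) : R := (-1) ^+ b.
(** The Walsh characters; [hat u T] is the Fourier coefficient at T of the sign function (-1)^u. *)
Definition chi T x : R := \prod_i (if i \in T then sg (x i) else 1).
Definition hat u T : R := Ex (fun x => sg (u x) * chi T x).

(** The sum over T is the expansion of the product of the factors 1 + sg (x i) * sg (y i): all equal
    2 if x = y, and a coordinate that differs gives 0. *)
Lemma sum_chi x y : \sum_T chi T x * chi T y = #|{: cube n}|%:R * (x == y)%:R.
Proof.
transitivity (\prod_(i < n) (sg (x i) * sg (y i) + 1)).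
  rewrite (bigA_distr _ _ (fun i => sg (x i) * sg (y i))); apply: eq_bigr => T _.
  rewrite -big_split; apply: eq_bigr => i _ /=.
  by case: (i \in T); rewrite ?mul1r.
case: eqP => [->|/eqP xy].
  rewrite mulr1 card_ffun card_bool card_ord natrX -[n in _ ^+ n]card_ord.
  rewrite -prodr_const; apply: eq_bigr => i _.
  by rewrite /sg -expr2 sqrr_sign.
have [i xyi] : exists i, x i != y i.
  by apply/existsP; apply: contraNT xy => /existsPn H; apply/eqP/ffunP => i;
    apply/eqP/negPn.
rewrite mulr0 (bigD1 i) //=; apply/eqP; rewrite mulf_eq0; apply/orP; left.
rewrite /sg; case: (x i) (y i) xyi => -[] //= _;
  by rewrite ?expr0 ?expr1 ?mul1r ?mulr1 addNr.
Qed.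

Lemma chi_inversion u x : sg (u x) = \sum_T hat u T * chi T x.
Proof.
transitivity (Ex (fun y => sg (u y) * (\sum_T chi T y * chi T x))).
  rewrite /Ex (bigD1 x) //= [X in _ + X]big1 => [|y yx].
    by rewrite sum_chi eqxx mulr1 addr0 mulfK // pnatr_eq0 -lt0n cube_gt0.
  by rewrite sum_chi (negPf yx) !mulr0.
rewrite (eq_Ex (fun y => mulr_sumr _ _ _ _)) Ex_sum; apply: eq_bigr => T _.
by rewrite /hat -ExZr; apply: eq_Ex => y; rewrite mulrA.
Qed.

Lemma Ex_chi_mix T J x :
  Ex (fun y => chi T (mix J x y)) = (T \subset J)%:R * chi T x.
Proof.
pose F i (b : bool) := if i \in T then sg (if i \in J then x i else b) else 1.
transitivity (Ex (fun y : cube n => \prod_i F i (y i))).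
  by apply: eq_Ex => y; apply: eq_bigr => i _; rewrite /F ffunE.
rewrite Ex_prod; case: (boolP (T \subset J)) => [/subsetP TJ|].
  rewrite mul1r; apply: eq_bigr => i _; rewrite /F; case: ifP => [/TJ->|_];
  by rewrite Ex_cst ?card_bool.
case/subsetPn => i iT iJ; rewrite mul0r (bigD1 i) //= /F iT (negPf iJ).
by rewrite /Ex big_bool /= /sg expr0 expr1 addNr !mul0r.
Qed.

(** Resampling outside J keeps the characters of subsets of J and averages all others to 0, so the
    correlation of u with its resampled copy is the Fourier weight inside J. *)
Lemma infl_fourier u J :
  infl u J = 2^-1 * (1 - \sum_(T : {set 'I_n} | T \subset J) hat u T ^+ 2).
Proof.
have sgE (a b : bool) : (a != b)%:R = 2^-1 * (1 - sg a * sg b).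
  by rewrite /sg; case: a; case: b => /=; rewrite ?expr0 ?expr1; lra.
transitivity (2^-1 * (1 - Ex (fun x => Ex (fun y => sg (u x) * sg (u (mix J x y)))))).
  rewrite -[X in X - _](Ex_cst 1 cube_gt0) -ExB -ExZ; apply: eq_Ex => x.
  rewrite -[X in X - _](Ex_cst 1 cube_gt0) -ExB -ExZ; apply: eq_Ex => y.
  exact: sgE.
congr (_ * (_ - _)).
transitivity (Ex (fun x => \sum_(T : {set 'I_n} | T \subset J) hat u T * (sg (u x) * chi T x))).
  apply: eq_Ex => x; rewrite ExZ.
  rewrite (eq_Ex (fun y => chi_inversion u (mix J x y))) Ex_sum mulr_sumr.
  rewrite [RHS]big_mkcond; apply: eq_bigr => T _.
  by rewrite ExZ Ex_chi_mix; case: ifP => _; rewrite ?mul1r ?mul0r ?mulr0 // mulrCA.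
by rewrite Ex_sum; apply: eq_bigr => T _; rewrite ExZ expr2.
Qed.

(* With w T half the squared Fourier coefficient of (-1)^u at T. *)
Lemma infl_coverage u : exists2 w : {set 'I_n} -> R, forall T, 0 <= w T &
  forall J, infl u J = \sum_(T : {set 'I_n} | ~~ (T \subset J)) w T.
Proof.
exists (fun T => 2^-1 * hat u T ^+ 2) => [T|J].
  by rewrite mulr_ge0 ?sqr_ge0 ?invr_ge0.
(* Parseval's identity, read off from [infl_fourier] at [setT]: nothing is resampled, so the
   influence is 0. *)
have sum1 : 1 = \sum_T hat u T ^+ 2.
  have := infl_fourier u setT.
  have -> : infl u setT = 0.
    rewrite /infl /Ex big1 ?mul0r // => x _; rewrite big1 ?mul0r // => y _.
    rewrite (_ : mix setT x y = x) ?eqxx //.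
    by apply/ffunP => i; rewrite ffunE inE.
  rewrite (eq_bigl predT); last by move=> T; rewrite subsetT.
  lra.
rewrite infl_fourier sum1 (bigID (fun T : {set 'I_n} => T \subset J)) /=.
by rewrite addrAC subrr add0r mulr_sumr.
Qed.

Lemma infl_anti u J J' : J \subset J' -> infl u J' <= infl u J.
Proof.
move=> JJ; have [w w0 wE] := infl_coverage u; rewrite !wE.
rewrite [leRHS](bigID (fun T : {set 'I_n} => ~~ (T \subset J'))) /= ler_wpDr ?sumr_ge0 //.
rewrite le_eqVlt; apply/orP; left; apply/eqP/eq_bigl => T.
case: (boolP (T \subset J')) => [|nTJ]; first by rewrite andbF.
by rewrite andbT; apply/esym; apply: contra nTJ => /subset_trans->.
Qed.

(** In the coverage form: a set not inside the intersection already fails to lie inside J or inside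
    J'. *)
Lemma infl_setI u J J' : infl u (J :&: J') <= infl u J + infl u J'.
Proof.
have [w w0 wE] := infl_coverage u; rewrite !wE.
rewrite [X in X <= _]big_mkcond [X in _ <= X + _]big_mkcond.
rewrite [X in _ <= _ + X]big_mkcond -big_split; apply: ler_sum => T _ /=.
rewrite subsetI; case: (T \subset J); case: (T \subset J') => //=;
  by rewrite ?addr0 ?add0r // ler_wpDl.
Qed.

Definition depends_within J h := forall x y, {in J, x =1 y} -> h x = h y.

Lemma distE u h : dist R u h = Ex (fun x => (u x != h x)%:R).
Proof. exact: esym (prE R _). Qed.

Lemma dist_sym u h : dist R u h = dist R h u.
Proof. by rewrite !distE; apply: eq_Ex => x; rewrite eq_sym. Qed.

Lemma dist_triangle u h h' : dist R u h' <= dist R u h + dist R h h'.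
Proof.
rewrite !distE -ExD; apply: le_Ex => x; rewrite -natrD ler_nat.
by case: (u x); case: (h x); case: (h' x).
Qed.

Lemma dist_relabel u h (s : {perm 'I_n}) : dist R (relabel u s) (relabel h s) = dist R u h.
Proof.
pose t (x : cube n) : cube n := [ffun i => x (s i)].
have tb : bijective t.
  exists (fun x : cube n => [ffun i => x ((s^-1)%g i)] : cube n) => x;
    by apply/ffunP => i; rewrite !ffunE ?permK ?permKV.
by rewrite !distE -[RHS](Ex_bij _ tb); apply: eq_Ex => x; rewrite !ffunE.
Qed.

(** Freezing the resampled coordinates at a value y that does no worse than average gives the
    junta. *)
Lemma infl_junta u J :
  exists2 h, depends_within J h & dist R u h <= infl u J.
Proof.
have : Ex (fun y => Ex (fun x => (u x != u (mix J x y))%:R)) <= infl u J.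
  by rewrite Ex_swap.
case/(exists_le_Ex cube_gt0) => y Hy.
exists [ffun x => u (mix J x y)].
  move=> x x' xx'; rewrite !ffunE; congr (u _); apply/ffunP => i.
  by rewrite !ffunE; case: ifP => // /xx'.
by rewrite distE; apply: le_trans Hy; apply: le_Ex => x; rewrite ffunE.
Qed.

(** Exchanging the coordinates outside J between x and y is an involution on pairs, so the mixed
    point is uniform. *)
Lemma Ex_mix J (F : cube n -> R) : Ex (fun x => Ex (fun y => F (mix J x y))) = Ex F.
Proof.
rewrite -(Ex_pair (fun p => F (mix J p.1 p.2))).
transitivity (Ex (fun p : cube n * cube n => F p.1)); last first.
  by rewrite Ex_pair; apply: eq_Ex => x /=; rewrite Ex_cst ?cube_gt0.
pose h (p : cube n * cube n) := (mix J p.1 p.2, mix J p.2 p.1).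
rewrite -(@Ex_bij _ _ _ h (fun p => F p.1)) //.
by apply: inv_bij => -[x y]; rewrite /h /=; congr (_, _); apply/ffunP => i;
  rewrite !ffunE; case: (i \in J).
Qed.

(** Influence compares values at two points, each of them uniform, so replacing u by h costs the
    distance twice. *)
Lemma infl_le_dist u h J : infl u J <= infl h J + 2 * dist R u h.
Proof.
have -> : infl h J + 2 * dist R u h =
    dist R u h + (infl h J + Ex (fun x => Ex (fun y =>
      (u (mix J x y) != h (mix J x y))%:R))).
  rewrite (Ex_mix J (fun x => (u x != h x)%:R)) -distE; ring.
have -> : dist R u h = Ex (fun x => Ex (fun y : cube n => (u x != h x)%:R)).
  by rewrite distE; apply: eq_Ex => x; rewrite Ex_cst ?cube_gt0.
rewrite -!ExD; apply: le_Ex => x; rewrite -!ExD; apply: le_Ex => y.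
rewrite -!natrD ler_nat.
by case: (u x); case: (h x); case: (u _); case: (h _).
Qed.

Lemma infl_depends_within h J : depends_within J h -> infl h J = 0.
Proof.
move=> hJ; rewrite /infl /Ex big1 ?mul0r // => x _; rewrite big1 ?mul0r // => y _.
by rewrite (hJ x (mix J x y)) ?eqxx // => i iJ; rewrite ffunE iJ.
Qed.

Lemma depends_within_sub J J' h :
  J \subset J' -> depends_within J h -> depends_within J' h.
Proof. by move=> /subsetP JJ hJ x y xy; apply: hJ => i /JJ; exact: xy. Qed.

Lemma depends_on_within h : depends_within [set i | depends_on h i] h.
Proof.
(* Walk from x to y one coordinate at a time; s lists the coordinates where they may still
   differ. *)
suff H (s : seq 'I_n) x y : {in [set i | depends_on h i], x =1 y} ->
    (forall i, i \notin s -> x i = y i) -> h x = h y.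
  move=> x y xy; apply: (H (enum 'I_n)) => // i.
  by rewrite mem_enum.
elim: s x => [|i s IH] x xy xys; first by congr (h _); apply/ffunP => i; exact: xys.
pose x' : cube n := [ffun j => if j == i then y i else x j].
rewrite -(IH x') => [|j /xy|j js]; last 2 first.
- by rewrite ffunE; case: eqP => // ->.
- by rewrite ffunE; case: eqP => [->|/eqP ji] //; apply: xys; rewrite inE negb_or ji.
case: (boolP (depends_on h i)) => [hi|].
  congr (h _); apply/ffunP => j; rewrite ffunE; case: eqP => // ->.
  by rewrite xy // inE.
rewrite negb_exists => /forallP/(_ x); rewrite negb_exists => /forallP/(_ x').
rewrite negb_and negbK => /orP[|/eqP//].
case/forallPn => j; rewrite negb_imply ffunE => /andP[/negPf->].
by rewrite eqxx.
Qed.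

End Influence.

(** * Random binning *)

Section Binning.
Variables (R : realType) (n : nat) (B A : finType) (g : B -> A).
Hypothesis B0 : (0 < #|B|)%N.
Implicit Types (u : boolfun n) (J : {set 'I_n}) (K : {set B}).
Implicit Types psi : {ffun 'I_n -> B}.

Definition pre psi K : {set 'I_n} := [set v | psi v \in K].

(** The map g forgets part of a bin. In the isomorphism test a bin is a pair in [L * bool] and only
    its first component must differ between relevant variables, so separation is measured through
    g. *)
Definition collprob : R := Ex (fun b => Ex (fun b' => (g b == g b')%:R)).

Definition separated psi J : bool := dinjectiveb (g \o psi) J.

Lemma pr_not_separated J :
  pr R (fun psi => ~~ separated psi J) <= #|J|%:R ^+ 2 * collprob.
Proof.
have c0 : 0 <= collprob by apply: Ex_ge0 => b; apply: Ex_ge0.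
apply: (@le_trans _ _ (\sum_(p : 'I_n * 'I_n | (p.1 \in J) && (p.2 \in J)
    && (p.1 != p.2)) Ex (fun psi => (g (psi p.1) == g (psi p.2))%:R))).
  rewrite -Ex_sum; apply: le_Ex => psi; rewrite -natr_sum ler_nat.
  case: (boolP (separated _ _)) => //= /dinjectivePn[v vJ [v' /andP[/= v'v v'J] vv']].
  by rewrite (bigD1 (v, v')) /= ?vJ ?v'J 1?eq_sym // [g _ == _]eq_sym vv' eqxx.
apply: (@le_trans _ _ (\sum_(p : 'I_n * 'I_n | (p.1 \in J) && (p.2 \in J)) collprob)).
  rewrite [leRHS](bigID (fun p : 'I_n * 'I_n => p.1 != p.2)) /=.
  rewrite ler_wpDr ?sumr_ge0 //; apply: ler_sum => p /andP[_ pp].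
  by rewrite (Ex_coord2 B0 (fun b b' => (g b == g b')%:R)).
rewrite -(pair_big (mem J) (mem J) (fun _ _ => collprob)) /= !sumr_const.
by rewrite -mulrnA -[X in X <= _]mulr_natl natrM expr2.
Qed.

Lemma separated_inj psi J : separated psi J -> {in J &, injective psi}.
Proof. by move=> /dinjectiveP gi v v' vJ v'J e; apply: gi; rewrite //= e. Qed.

Lemma card_setI_pre psi K J : {in J &, injective psi} ->
  (#|J :&: pre psi K| <= #|K|)%N.
Proof.
move=> inj; rewrite -(@card_in_imset _ _ psi) => [|v v' /setIP[vJ _] /setIP[v'J _]].
  by apply/subset_leq_card/subsetP => b /imsetP[v /setIP[_]]; rewrite inE => vK ->.
exact: inj.
Qed.

Section Bad.
Variables (u : boolfun n) (k : nat) (d : R).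
Hypothesis d0 : 0 <= d.

Definition badbin psi :=
  [exists K : {set B}, (#|K| <= k)%N && (infl R u (pre psi K) <= d)].

(** One witness is fixed per binning, which makes [V psi] a random set that can be averaged over;
    the default is only taken when psi is not bad. *)
Let bad_witness psi : {set B} :=
  odflt set0 [pick K : {set B} | (#|K| <= k)%N && (infl R u (pre psi K) <= d)].

Let V psi : {set 'I_n} := pre psi (bad_witness psi).

Let bad_witnessP psi : badbin psi ->
  (#|bad_witness psi| <= k)%N /\ infl R u (V psi) <= d.
Proof.
rewrite /badbin /V /bad_witness; case: pickP => [K /andP[]//|H] /existsP[K].
by rewrite H.
Qed.

(* Drawing T from the coverage weights conditioned on T not inside J, a bad
   binning misses T with probability at most d / (2 d). *)
Let greedy_step J : 2 * d < infl R u J -> exists2 e, e \notin J &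
  pr R badbin <= 2 * pr R (fun psi => badbin psi && (e \in V psi)).
Proof.
have [w w0 wE] := infl_coverage R u => dJ.
pose bE psi : R := (badbin psi)%:R.
have key : infl R u J * pr R badbin <= \sum_(T : {set 'I_n} | ~~ (T \subset J))
    w T * (2 * Ex (fun psi => bE psi * (T \subset V psi)%:R)).
  rewrite /pr -ExZ.
  have -> : \sum_(T : {set 'I_n} | ~~ (T \subset J))
      w T * (2 * Ex (fun psi => bE psi * (T \subset V psi)%:R)) =
    Ex (fun psi => \sum_(T : {set 'I_n} | ~~ (T \subset J))
      w T * (2 * (bE psi * (T \subset V psi)%:R))).
    by rewrite Ex_sum; apply: eq_bigr => T _; rewrite !ExZ.
  apply: le_Ex => psi; rewrite /bE; case: (boolP (badbin psi)) => [bad|_]; last first.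
    by rewrite mulr0 sumr_ge0 // => T _; rewrite mul0r !mulr0.
  (* A set T not inside J either lies inside [V psi] or counts towards its influence, which is at
     most d and so less than half the influence of J. *)
  have [_ Vd] := bad_witnessP bad; rewrite mulr1.
  have : infl R u J <= \sum_(T : {set 'I_n} | ~~ (T \subset J))
      w T * (T \subset V psi)%:R + infl R u (V psi).
    rewrite !wE; rewrite [X in _ <= _ + X]big_mkcond /=.
    rewrite [X in X <= _]big_mkcond [X in _ <= X + _]big_mkcond -big_split /=.
    apply: ler_sum => T _; case: (T \subset J); case: (T \subset V psi) => /=;
      by rewrite ?mulr1 ?mulr0 ?addr0 ?add0r.
  have -> : \sum_(T : {set 'I_n} | ~~ (T \subset J))
      w T * (2 * (true%:R * (T \subset V psi)%:R)) =
    2 * \sum_(T : {set 'I_n} | ~~ (T \subset J)) w T * (T \subset V psi)%:R.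
    by rewrite mulr_sumr; apply: eq_bigr => T _; rewrite mul1r mulrCA.
  lra.
have [T TJ HT] : exists2 T : {set 'I_n}, ~~ (T \subset J) &
    pr R badbin <= 2 * Ex (fun psi => bE psi * (T \subset V psi)%:R).
  (* Otherwise every gap [G S] is positive, while their weighted sum is at most 0 by [key]; all
     weights outside J then vanish and J has influence 0, contradicting 2 d < infl u J. *)
  apply/exists_inP; apply: contraLR dJ => /exists_inPn H.
  rewrite -leNgt (@le_trans _ _ 0) ?mulr_ge0 // wE big1 // => T TJ.
  pose G (S : {set 'I_n}) : R :=
    pr R badbin - 2 * Ex (fun psi => bE psi * (S \subset V psi)%:R).
  have G0 (S : {set 'I_n}) : ~~ (S \subset J) -> 0 < G S.
    by move=> /H; rewrite -ltNge subr_gt0.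
  have sum0 : \sum_(S : {set 'I_n} | ~~ (S \subset J)) w S * G S = 0.
    apply/eqP; rewrite eq_le; apply/andP; split; last first.
      by apply: sumr_ge0 => S /G0/ltW GS; rewrite mulr_ge0.
    rewrite (eq_bigr (fun S => w S * pr R badbin - w S * (2 *
      Ex (fun psi => bE psi * (S \subset V psi)%:R)))) => [|S _].
      by rewrite sumrB -mulr_suml -wE subr_le0.
    by rewrite /G mulrBr.
  have /(_ T TJ)/eqP := psumr_eq0P (fun S SJ => mulr_ge0 (w0 S) (ltW (G0 S SJ))) sum0.
  by rewrite mulf_eq0 (gt_eqF (G0 T TJ)) orbF => /eqP.
have [e eT eJ] := subsetPn TJ; exists e => //; apply: le_trans HT _.
rewrite ler_pM2l //; apply: le_Ex => psi; rewrite -natrM ler_nat mulnb.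
by case: (badbin psi) => //=; case: (boolP (T \subset _)) => // /subsetP->.
Qed.

Let greedy m : (forall J, (#|J| < m)%N -> 2 * d < infl R u J) ->
  exists2 J : {set 'I_n}, #|J| = m & forall e, e \in J ->
    pr R badbin <= 2 * pr R (fun psi => badbin psi && (e \in V psi)).
Proof.
elim: m => [|m IH] large; first by exists set0; rewrite ?cards0 // => e; rewrite inE.
have [J Jm HJ] := IH (fun J Jm => large J (ltnW Jm)).
have [e eJ He] := greedy_step (large J (eq_leq (congr1 S Jm))).
exists (e |: J); first by rewrite cardsU1 eJ Jm.
by move=> e' /setU1P[->|/HJ].
Qed.

(* Either some set J of fewer than 2 k + 2 variables already captures u, and it
   is enough that psi separates J; or greedy_step yields 2 k + 2 variables of
   which a bad binning captures k + 1 on average, so that two of them collide. *)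
Lemma pr_badbin : (forall J, (#|J| <= k)%N -> 3 * d < infl R u J) ->
  pr R badbin <= (k + 2)%:R * (2 * k + 2)%:R ^+ 2 * collprob.
Proof.
move=> far; have c0 : 0 <= collprob by apply: Ex_ge0 => b; apply: Ex_ge0.
have [|] := boolP [exists J : {set 'I_n}, (#|J| < 2 * k + 2)%N && (infl R u J <= 2 * d)].
  case/existsP => J /andP[Jt Jd].
  apply: (@le_trans _ _ (pr R (fun psi => ~~ separated psi J))).
    (* If psi separated J, the intersection of J with [V psi] would have at most k variables and
       influence at most 2 d + d, against [far]. *)
    apply: le_pr => psi /bad_witnessP[Kk Vd]; apply/negP => /separated_inj inj.
    have := far (J :&: V psi) (leq_trans (card_setI_pre _ inj) Kk).
    have := infl_setI R u J (V psi); lra.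
  apply: le_trans (pr_not_separated _) _; rewrite ler_wpM2r //.
  rewrite -!natrX -natrM ler_nat; nia.
move/existsPn => H.
have [|J Jm HJ] := @greedy (2 * k + 2).
  by move=> J Jt; have := H J; rewrite Jt /= -ltNge.
have : (2 * k + 2)%:R * pr R badbin <= 2 * Ex (fun psi =>
    \sum_(e in J) (badbin psi && (e \in V psi))%:R).
  rewrite Ex_sum mulr_sumr -Jm mulr_natl -sumr_const.
  by apply: ler_sum => e /HJ.
have : Ex (fun psi => \sum_(e in J) (badbin psi && (e \in V psi))%:R) <=
    k%:R * pr R badbin + (k + 2)%:R * pr R (fun psi => ~~ separated psi J).
  rewrite -!ExZ -ExD; apply: le_Ex => psi.
  rewrite -natr_sum -!natrM -natrD ler_nat.
  case: (boolP (badbin psi)) => [/bad_witnessP[Kk _]|_]; last by rewrite big1.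
  have -> : (\sum_(e in J) (true && (e \in V psi)) = #|J :&: V psi|)%N.
    rewrite -sum1_card [RHS]big_mkcond [LHS]big_mkcond; apply: eq_bigr => e _.
    by rewrite in_setI; case: (e \in J); case: (e \in V psi).
  (* With J separated, each witness bin holds at most one variable of J, so at most k are captured;
     otherwise at most 2 k + 2 = k + (k + 2). Comparing with the lower bound (k + 1) Pr[bad], the k
     terms cancel. *)
  case: (boolP (separated psi J)) => [/separated_inj inj|_] /=.
    by rewrite muln0 addn0 muln1 (leq_trans (card_setI_pre _ inj) Kk).
  rewrite !muln1 (leq_trans (subset_leq_card (subsetIl _ _))) // Jm; lia.
have := pr_not_separated J; rewrite Jm.
have k0 : 0 <= k%:R :> R by [].
have -> : (2 * k + 2)%:R = 2 * k%:R + 2 :> R by rewrite natrD natrM.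
have -> : (k + 2)%:R = k%:R + 2 :> R by rewrite natrD.
set P := pr R _; set S := Ex _; set Q := pr R _ => Q1 H1 H2.
have : (k%:R + 2) * P <= (k%:R + 2) * ((2 * k%:R + 2) ^+ 2 * collprob).
  by rewrite ler_wpM2l // addr_ge0.
have -> : (k%:R + 2) * (2 * k%:R + 2) ^+ 2 * collprob =
  (k%:R + 2) * ((2 * k%:R + 2) ^+ 2 * collprob) by rewrite mulrA.
lra.
Qed.

End Bad.
End Binning.

(** * The junta test *)

Lemma minority_complement (r : nat) (bad : pred 'I_r) :
  (2 * #|[set i | bad i]| < r)%N -> (r <= 2 * #|[set i | ~~ bad i]|)%N.
Proof.
have := cardsC [set i | bad i]; rewrite card_ord.
have -> : ~: [set i | bad i] = [set i | ~~ bad i] by apply/setP => i; rewrite !inE.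
by move: #|_| #|_| => a b; lia.
Qed.

(** Two-stage union bound: P is the failure of the first draw, and c bounds the failure of the
    second one once the first is fixed and good. *)
Lemma pr_pair_le (R : realType) (T U : finType) (P : pred T) (Q : pred (T * U)) (c : R) :
  (0 < #|T|)%N -> 0 <= c -> (forall x, ~~ P x -> pr R (fun y => Q (x, y)) <= c) ->
  pr R Q <= pr R P + c.
Proof.
move=> T0 c0 H; rewrite {1}/pr Ex_pair -[X in _ + X](Ex_cst c T0) -ExD.
apply: le_Ex => x; case: (boolP (P x)) => [_|/H]; last by rewrite add0r.
by rewrite -[X in X <= _]addr0 lerD // pr_le1.
Qed.

Section JuntaTest.
Variables (R : realType) (n k : nat) (B A : finType) (g : B -> A).
Hypothesis B0 : (0 < #|B|)%N.
Implicit Types (u : boolfun n) (psi : {ffun 'I_n -> B}) (kappa : {ffun 'I_k -> B}).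

(* The 'I_4-valued coordinates select each bin with probability 3 / 4, so that
   k given bins are all selected with probability (3 / 4) ^ k >= 2 ^ (- k / 2). *)
Definition jsample : finType := ({ffun B -> 'I_4} * (cube n * cube n))%type.

Definition supp (s : {ffun B -> 'I_4}) : {set B} := [set b | s b != ord0].
Definition covers (s : {ffun B -> 'I_4}) kappa : bool := [forall t, kappa t \in supp s].
Definition bins kappa : {set B} := [set kappa t | t : 'I_k].

Definition jmix psi (s : jsample) : cube n := mix (pre psi (supp s.1)) s.2.1 s.2.2.
Definition hit u psi kappa (s : jsample) : bool :=
  covers s.1 kappa && (u s.2.1 != u (jmix psi s)).

Lemma jsample_gt0 : (0 < #|jsample|)%N.
Proof. by rewrite !card_prod !muln_gt0 card_ffun card_ord expn_gt0 /= cube_gt0. Qed.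

Lemma pr_hitE u psi kappa : pr R (hit u psi kappa) =
  Ex (fun s => (covers s kappa)%:R * infl R u (pre psi (supp s))).
Proof.
rewrite /pr Ex_pair; apply: eq_Ex => s; rewrite Ex_pair -ExZ; apply: eq_Ex => x.
by rewrite -ExZ; apply: eq_Ex => y; rewrite -natrM mulnb.
Qed.

(** A product over bins, so that [Ex_prod] applies to the independent selections. *)
Lemma coversE s kappa :
  (covers s kappa)%:R = \prod_b (if b \in bins kappa then (s b != ord0)%:R else 1) :> R.
Proof.
case: (boolP (covers s kappa)) => [/forallP H|/forallPn[t Ht]].
  rewrite big1 // => b _; case: ifP => // /imsetP[t _ ->].
  by have := H t; rewrite inE => ->.
rewrite (bigD1 (kappa t)) //= imset_f // -[_ != _]/(_ != ord0).
by move: Ht; rewrite inE negbK => /eqP->; rewrite eqxx mul0r.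
Qed.

Lemma Ex_nonzero4 : Ex (fun x : 'I_4 => (x != ord0)%:R : R) = 3 / 4.
Proof. by rewrite /Ex card_ord 4!big_ord_recl big_ord0 /=; lra. Qed.

Lemma Ex_zero4 : Ex (fun x : 'I_4 => (x == ord0)%:R : R) = 4^-1.
Proof. by rewrite /Ex card_ord 4!big_ord_recl big_ord0 /=; lra. Qed.

Let I4 : (0 < #|'I_4|)%N. Proof. by rewrite card_ord. Qed.

Section Separate.
Variables (u : boolfun n) (psi : {ffun 'I_n -> B}) (kappa : {ffun 'I_k -> B}).
Hypothesis kinj : injective kappa.

Let card_bins : #|bins kappa| = k.
Proof. by rewrite card_imset // card_ord. Qed.

Let prod_bins (a : R) : \prod_b (if b \in bins kappa then a else 1) = a ^+ k.
Proof. by rewrite -big_mkcond /= prodr_const card_bins. Qed.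

Lemma pr_covers : Ex (fun s => (covers s kappa)%:R : R) = (3 / 4) ^+ k.
Proof.
pose F b (x : 'I_4) : R := if b \in bins kappa then (x != ord0)%:R else 1.
transitivity (Ex (fun s : {ffun B -> 'I_4} => \prod_b F b (s b))).
  by apply: eq_Ex => s; rewrite coversE.
rewrite Ex_prod -prod_bins; apply: eq_bigr => b _; rewrite /F.
by case: ifP => _; rewrite ?Ex_nonzero4 ?Ex_cst.
Qed.

(** Once all bins of kappa are selected, the selected set contains them, and influence decreases as
    the kept set grows. *)
Lemma pr_hit_le : pr R (hit u psi kappa) <= (3 / 4) ^+ k * infl R u (pre psi (bins kappa)).
Proof.
rewrite pr_hitE -pr_covers -ExZr; apply: le_Ex => s.
case: (boolP (covers s kappa)) => [/forallP H|_]; last by rewrite !mul0r.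
rewrite !mul1r; apply: infl_anti; apply/subsetP => v; rewrite !inE.
by case/imsetP => t _ ->; have := H t; rewrite inE.
Qed.

(* A bin outside kappa meeting T is unselected with probability 1 / 4. *)
Lemma pr_hit_ge :
  (3 / 4) ^+ k / 4 * infl R u (pre psi (bins kappa)) <= pr R (hit u psi kappa).
Proof.
have [w w0 wE] := infl_coverage R u; rewrite pr_hitE wE mulr_sumr.
apply: (@le_trans _ _ (Ex (fun s => \sum_(T : {set 'I_n} | ~~ (T \subset pre psi (bins kappa)))
    w T * ((covers s kappa)%:R * (~~ (T \subset pre psi (supp s)))%:R)))); last first.
  apply: le_Ex => s; rewrite wE mulr_sumr.
  rewrite [leLHS]big_mkcond [leRHS]big_mkcond; apply: ler_sum => T _.
  case: (T \subset pre psi (supp s)); case: (T \subset _) => /=;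
    rewrite ?mulr0 ?mulr1 // ?mulr_ge0 //.
  by rewrite mulrC.
rewrite Ex_sum; apply: ler_sum => T /subsetPn[v vT]; rewrite inE => vk.
rewrite ExZ mulrC ler_wpM2l //.
pose F b (x : 'I_4) : R := if b \in bins kappa then (x != ord0)%:R else
  if b == psi v then (x == ord0)%:R else 1.
apply: (@le_trans _ _ (Ex (fun s : {ffun B -> 'I_4} => \prod_b F b (s b)))).
  rewrite Ex_prod (bigD1 (psi v)) //= {1}/F (negPf vk) eqxx Ex_zero4 mulrC.
  rewrite ler_pM2l ?invr_gt0 // -prod_bins (bigD1 (psi v)) //= (negPf vk) mul1r.
  rewrite le_eqVlt; apply/orP; left; apply/eqP/eq_bigr => b /negPf bv; rewrite /F bv.
  by case: ifP => _; rewrite ?Ex_nonzero4 ?Ex_cst.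
apply: le_Ex => s; rewrite (bigD1 (psi v)) //= {1}/F (negPf vk) eqxx.
case: (boolP (s (psi v) == ord0)) => [sv|]; last by rewrite mul0r mulr_ge0.
have -> : T \subset pre psi (supp s) = false.
  by apply/negbTE/subsetPn; exists v => //; rewrite !inE sv.
rewrite mulr1 mul1r coversE [leRHS](bigD1 (psi v)) //= (negPf vk) mul1r.
by rewrite le_eqVlt; apply/orP; left; apply/eqP/eq_bigr => b /negPf bv; rewrite /F bv.
Qed.

End Separate.

Variables (r q : nat).
Definition jcoins : finType :=
  ({ffun 'I_n -> B} * {ffun 'I_r -> {ffun 'I_q -> jsample}})%type.

Definition jbad u psi kappa (w : {ffun 'I_q -> jsample}) : bool :=
  [exists j, hit u psi kappa (w j)].
(** A vote over r batches. Injectivity through g is part of the test because the isomorphism test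
    needs the labels on the bins of kappa to be uniform. *)
Definition jpass u (om : jcoins) kappa : bool :=
  injectiveb (g \o kappa) &&
  (2 * #|[set i | jbad u om.1 kappa (om.2 i)]| < r)%N.

Let batch0 : (0 < #|{ffun 'I_q -> jsample}|)%N.
Proof. exact: card_ffun_gt0 jsample_gt0. Qed.

Let psi0 : (0 < #|{ffun 'I_n -> B}|)%N.
Proof. exact: card_ffun_gt0. Qed.

Lemma jcoins_gt0 : (0 < #|jcoins|)%N.
Proof. by rewrite card_prod muln_gt0 psi0 card_ffun_gt0. Qed.

Lemma pr_jbad_le u psi kappa :
  pr R (jbad u psi kappa) <= q%:R * pr R (hit u psi kappa).
Proof.
apply: le_trans (pr_exists _ _) _; rewrite mulr_natl -[q in leRHS]card_ord -sumr_const.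
apply: ler_sum => j _.
by rewrite /pr (Ex_coord jsample_gt0 j (fun s => (hit u psi kappa s)%:R)).
Qed.

(** A batch has no hit with probability (1 - p)^q, and 1 / (1 + q p) is a rational substitute for
    exp (- q p). *)
Lemma pr_not_jbad_le u psi kappa : 0 <= q%:R * pr R (hit u psi kappa) ->
  pr R (fun w => ~~ jbad u psi kappa w) <= (1 + q%:R * pr R (hit u psi kappa))^-1.
Proof.
set p := pr R _ => qp0.
have -> : pr R (fun w => ~~ jbad u psi kappa w) = (1 - p) ^+ q.
  transitivity (Ex (fun w : {ffun 'I_q -> jsample} =>
      \prod_j ((~~ hit u psi kappa (w j))%:R : R))).
    apply: eq_Ex => w; rewrite /jbad negb_exists.
    case: (boolP [forall j, _]) => [/forallP H|/forallPn[j]].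
      by rewrite big1 // => j _; rewrite H.
    by rewrite negbK => hj; rewrite (bigD1 j) //= hj mul0r.
  rewrite (Ex_prod (fun _ s => (~~ hit u psi kappa s)%:R)) prodr_const card_ord.
  by congr (_ ^+ q); apply: prC jsample_gt0.
have p0 : 0 <= p by apply: pr_ge0.
have p1 : p <= 1 by apply: pr_le1.
(* Induction on q by (1 - p) (1 + (m + 1) p) <= 1 + m p. *)
have : (1 - p) ^+ q * (1 + q%:R * p) <= 1.
  elim: q {qp0} => [|m IH]; first by rewrite expr0 mul0r; lra.
  apply: le_trans IH; rewrite exprSr -mulrA; apply: ler_wpM2l.
    by rewrite exprn_ge0 // subr_ge0.
  have m0 : 0 <= m%:R :> R by [].
  have := mulr_ge0 (mulr_ge0 m0 p0) p0.
  rewrite -natr1; nra.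
by rewrite -[X in _ -> _ <= X]mul1r ler_pdivlMr ?ltr_pwDl.
Qed.

(** The first error term is that two of the k variables share a coarse bin. Otherwise their bins
    have influence at most tau, a batch contains a hit with probability at most 1/20, and [majority]
    gives the second term. *)
Lemma jpass_complete u (tau : R) (e : 'I_k -> 'I_n) :
  q%:R * ((3 / 4) ^+ k * tau) <= 20^-1 -> injective e ->
  infl R u [set e t | t : 'I_k] <= tau ->
  pr R (fun om : jcoins => ~~ jpass u om [ffun t => om.1 (e t)]) <=
    k%:R ^+ 2 * collprob R g + 2^-1 ^+ r.
Proof.
move=> q_le einj Itau.
pose P (psi : {ffun 'I_n -> B}) := ~~ separated g psi [set e t | t : 'I_k].
apply: (@le_trans _ _ (pr R P + 2^-1 ^+ r)); last first.
  rewrite lerD2r; apply: le_trans (pr_not_separated _ _ B0 _) _.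
  by rewrite card_imset // card_ord.
apply: (@pr_pair_le) => // [|psi]; first by rewrite exprn_ge0 // invr_ge0.
rewrite negbK => sep; set kappa := [ffun t => psi (e t)].
have ginj : injective (g \o kappa).
  move=> t t' /=; rewrite !ffunE => gt; apply: einj.
  by move/dinjectiveP: sep; apply; rewrite ?imset_f.
have kinj : injective kappa by move=> t t' tt; apply: ginj; rewrite /= tt.
apply: le_trans (@majority R _ r (jbad u psi kappa) batch0 _).
  apply: le_pr => w; rewrite /jpass /= -/kappa.
  by move/injectiveP: ginj => ->; rewrite /= -leqNgt.
apply: le_trans (pr_jbad_le _ _ _) _; apply: le_trans q_le.
rewrite ler_wpM2l //; apply: le_trans (pr_hit_le _ _ kinj) _.
rewrite ler_wpM2l ?exprn_ge0 ?divr_ge0 //; apply: le_trans Itau.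
apply: infl_anti; apply/subsetP => v /imsetP[t _ ->]; rewrite inE.
by apply/imsetP; exists t => //; rewrite ffunE.
Qed.

Section Sound.
Variables (u : boolfun n) (delta : R).
Hypothesis q_ge : 19 <= q%:R * ((3 / 4) ^+ k / 4 * delta).

(** The expected number of hits per batch is at least 19, so a batch without hits has probability at
    most 1 / (1 + 19), and passing needs a majority of such batches. *)
Lemma jpass_sound_fixed psi kappa : delta <= infl R u (pre psi (bins kappa)) ->
  pr R (fun w => jpass u (psi, w) kappa) <= 2^-1 ^+ r.
Proof.
move=> Id; case: (boolP (injectiveb (g \o kappa))) => [/injectiveP ginj|ng]; last first.
  rewrite /pr /jpass (negPf ng) /Ex /= big1 ?mul0r ?exprn_ge0 ?invr_ge0 //.
have kinj : injective kappa by move=> t t' tt; apply: ginj; rewrite /= tt.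
apply: le_trans (@majority R _ r (fun w => ~~ jbad u psi kappa w) batch0 _).
  by apply: le_pr => w /andP[_] /=; exact: minority_complement.
have H : 19 <= q%:R * pr R (hit u psi kappa).
  apply: le_trans q_ge _; rewrite ler_wpM2l //.
  apply: le_trans (pr_hit_ge _ _ kinj).
  by rewrite ler_wpM2l // divr_ge0 ?exprn_ge0 // divr_ge0.
apply: le_trans (pr_not_jbad_le _) _; first by lra.
by rewrite lef_pV2 ?posrE; lra.
Qed.

Lemma jpass_sound : pr R (fun om : jcoins => [exists kappa,
    jpass u om kappa && (delta <= infl R u (pre om.1 (bins kappa)))]) <=
  #|B|%:R ^+ k * 2^-1 ^+ r.
Proof.
apply: le_trans (pr_exists _ _) _.
have -> : #|B|%:R ^+ k * 2^-1 ^+ r = \sum_(kappa : {ffun 'I_k -> B}) 2^-1 ^+ r :> R.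
  by rewrite sumr_const card_ffun card_ord -[RHS]mulr_natl natrX.
apply: ler_sum => kappa _.
(* An empty exceptional event for the binning turns [pr_pair_le] into plain conditioning on psi. *)
rewrite -[leRHS]add0r -[X in X + _](_ : pr R (fun _ : {ffun 'I_n -> B} => false) = 0).
  apply: (@pr_pair_le) => // [|psi _]; first by rewrite exprn_ge0 // invr_ge0.
  rewrite /=; case: (leP delta _) => [Id|_].
    by apply: le_trans (jpass_sound_fixed Id); apply: le_pr => w /andP[].
  rewrite /pr /Ex big1 ?mul0r ?exprn_ge0 ?invr_ge0 // => w _.
  by rewrite andbF.
by rewrite /pr /Ex big1 ?mul0r.
Qed.

(** If a tuple passes, either its bins have influence below delta and the binning is bad, or the
    event of [jpass_sound] occurs. *)
Lemma jpass_reject : 0 <= delta ->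
  (forall J : {set 'I_n}, (#|J| <= k)%N -> 3 * delta < infl R u J) ->
  pr R (fun om : jcoins => [exists kappa, jpass u om kappa]) <=
    (k + 2)%:R * (2 * k + 2)%:R ^+ 2 * collprob R g + #|B|%:R ^+ k * 2^-1 ^+ r.
Proof.
move=> delta0 far.
have := pr_badbin g B0 delta0 far; set P := pr R _ => HP.
have P0 : pr R (fun om : jcoins => badbin u k delta om.1) = P.
  rewrite /pr Ex_pair; apply: eq_Ex => psi /=.
  by rewrite Ex_cst // card_ffun_gt0.
apply: le_trans (lerD HP jpass_sound).
rewrite -P0; apply: le_trans (prU _ _ _); apply: le_pr => om /existsP[kappa pk].
case: (boolP (badbin _ _ _ _)) => //= nb; apply/existsP; exists kappa.
rewrite pk /= leNgt; apply/negP => H; case/negP: nb; apply/existsP; exists (bins kappa).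
by rewrite (ltW H) andbT (leq_trans (leq_imset_card _ _)) // card_ord.
Qed.

End Sound.
End JuntaTest.

(** * Counting collisions *)

Lemma perm_extension (T : finType) (S : {set T}) (p : T -> T) :
  {in S &, injective p} -> exists s : {perm T}, {in S, s =1 p}.
Proof.
elim: {S}#|S| {-2}S (erefl #|S|) => [|m IH] S.
  by move/eqP; rewrite cards_eq0 => /eqP-> _; exists 1%g => x; rewrite inE.
move=> Sm inj; have /card_gt0P[x xS] : (0 < #|S|)%N by rewrite Sm.
have [||s Hs] := IH (S :\ x).
- by have := cardsD1 x S; rewrite xS Sm => -[].
- by move=> y y' /setD1P[_ yS] /setD1P[_ y'S]; exact: inj.
(* The transposition corrects the image of x; by injectivity no other point of S is sent to [s x] or
   [p x], so the rest is undisturbed. *)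
exists (s * tperm (s x) (p x))%g => y yS; rewrite permM.
have [->|yx] := eqVneq y x; first by rewrite tpermL.
have ysx : s y = p y by apply: Hs; rewrite !inE yx.
rewrite -ysx tpermD //; first by rewrite (inj_eq perm_inj) eq_sym.
by rewrite ysx; apply: contraNneq yx => /inj->.
Qed.

Lemma partial_injection_extension (n k : nat) (S : {set 'I_k}) (p : 'I_k -> 'I_n) :
  (k <= n)%N -> {in S &, injective p} ->
  exists2 a : 'I_k -> 'I_n, injective a & {in S, a =1 p}.
Proof.
move=> kn inj.
pose p' (i : 'I_n) := if insub (val i) is Some t then p t else i.
have p'E t : p' (widen_ord kn t) = p t.
  by rewrite /p' /= insubT //= => lt_tk; congr p; exact: val_inj.
have [|s Hs] := @perm_extension _ (widen_ord kn @: S) p'.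
  by move=> i j /imsetP[t tS ->] /imsetP[t' t'S ->]; rewrite !p'E => /inj->.
exists (fun t => s (widen_ord kn t)) => [t t' /perm_inj /(congr1 val) /= tt|t tS].
  exact: val_inj.
by rewrite Hs ?imset_f.
Qed.

(** * Second moments and the birthday count *)

Section SecondMoment.
Variable R : realType.

Lemma sum_ord_const (m : nat) (a : R) : \sum_(i < m) a = m%:R * a.
Proof. by rewrite sumr_const card_ord mulr_natl. Qed.

(** The first term is the diagonal; the off-diagonal pairs are independent, and their number is
    rounded up to m^2. *)
Lemma second_moment (T : finType) (m : nat) (F : T -> R) : (0 < #|T|)%N ->
  (forall x, 0 <= F x) ->
  Ex (fun w : {ffun 'I_m -> T} => (\sum_i F (w i)) ^+ 2) <=
    m%:R * Ex (fun x => F x ^+ 2) + m%:R ^+ 2 * Ex F ^+ 2.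
Proof.
move=> T0 F0.
rewrite (eq_Ex (G := fun w : {ffun 'I_m -> T} =>
  \sum_i \sum_j F (w i) * F (w j))); last first.
  by move=> w; rewrite expr2 big_distrlr.
rewrite Ex_sum.
have -> : m%:R * Ex (fun x => F x ^+ 2) + m%:R ^+ 2 * Ex F ^+ 2 =
    \sum_(i < m) (Ex (fun x => F x ^+ 2) + m%:R * Ex F ^+ 2).
  by rewrite sum_ord_const mulrDr expr2 mulrA.
apply: ler_sum => i _; rewrite Ex_sum (bigD1 i) //=; apply: lerD.
  by rewrite (Ex_coord T0 i (fun x => F x * F x)).
have -> : m%:R * Ex F ^+ 2 = \sum_(j < m) Ex F ^+ 2.
  by rewrite sum_ord_const.
rewrite [leRHS](bigD1 i) //= ler_wpDl ?sqr_ge0 //; apply: ler_sum => j ji.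
by rewrite Ex_coord2M 1?eq_sym.
Qed.

Section Collisions.
Variables (Z W : finType) (ev : Z -> W -> bool) (m : nat) (c : R).
Hypotheses (Z0 : (0 < #|Z|)%N) (W0 : (0 < #|W|)%N).

(** Two independent lists of m samples provide m^2 pairs, which is why about 2^(k/2) samples suffice
    for events of probability about 2^-k. *)
Definition collisions (s : {ffun 'I_m -> Z} * {ffun 'I_m -> W}) : R :=
  \sum_i \sum_j (ev (s.1 i) (s.2 j))%:R.

Let P : R := Ex (fun z => Ex (fun w => (ev z w)%:R)).

Lemma collisions_ge0 s : 0 <= collisions s.
Proof. by rewrite sumr_ge0 // => i _; rewrite sumr_ge0. Qed.

Lemma Ex_collisions : Ex collisions = m%:R ^+ 2 * P.
Proof.
rewrite Ex_pair /= Ex_swap.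
transitivity (Ex (fun w : {ffun 'I_m -> W} =>
    m%:R * \sum_j Ex (fun z => (ev z (w j))%:R : R))).
  apply: eq_Ex => w; rewrite Ex_sum -sum_ord_const.
  apply: eq_bigr => i _; rewrite -Ex_sum.
  by rewrite (Ex_coord Z0 i (fun z => \sum_j (ev z (w j))%:R)).
rewrite ExZ Ex_sum expr2 -mulrA; congr (_ * _).
rewrite -sum_ord_const; apply: eq_bigr => j _.
by rewrite (Ex_coord W0 j (fun w => Ex (fun z => (ev z w)%:R))) -Ex_swap.
Qed.

(** [second_moment] is applied over the first list with the second one fixed, then over the second.
    Pairs of pairs sharing one sample are controlled by c, the chance that a given sample meets a
    random one. *)
Lemma Ex_collisions_sq :
  (forall z, Ex (fun w => (ev z w)%:R) <= c) ->
  (forall w, Ex (fun z => (ev z w)%:R) <= c) ->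
  Ex (fun s => collisions s ^+ 2) <=
    m%:R ^+ 2 * P + 2 * m%:R ^+ 3 * c * P + (m%:R ^+ 2 * P) ^+ 2.
Proof.
move=> degZ degW.
have m0 : 0 <= m%:R :> R by [].
have dZ0 z : 0 <= Ex (fun w => (ev z w)%:R) :> R by apply: Ex_ge0.
have dW0 w : 0 <= Ex (fun z => (ev z w)%:R) :> R by apply: Ex_ge0.
have boolsq (b : bool) : (b%:R ^+ 2 : R) = b%:R by case: b; rewrite ?expr1n ?expr0n.
pose S (w : {ffun 'I_m -> W}) z : R := \sum_j (ev z (w j))%:R.
apply: (@le_trans _ _ (Ex (fun w => m%:R * Ex (fun z => S w z ^+ 2) +
    m%:R ^+ 2 * Ex (S w) ^+ 2))).
  rewrite Ex_pair /= Ex_swap; apply: le_Ex => w.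
  by apply: second_moment => // z; rewrite sumr_ge0.
rewrite ExD !ExZ.
have H1 : Ex (fun w => Ex (fun z => S w z ^+ 2)) <= m%:R * P + m%:R ^+ 2 * (c * P).
  rewrite Ex_swap /P -!ExZ -ExD; apply: le_Ex => z.
  apply: le_trans (@second_moment _ m (fun w => (ev z w)%:R) W0 _) _ => //.
  rewrite (eq_Ex (fun w => boolsq (ev z w))) lerD2l ler_wpM2l ?exprn_ge0 //.
  by rewrite expr2 ler_wpM2r.
have H2 : Ex (fun w => Ex (S w) ^+ 2) <= m%:R * (c * P) + m%:R ^+ 2 * P ^+ 2.
  rewrite (eq_Ex (G := fun w : {ffun 'I_m -> W} =>
    (\sum_j Ex (fun z => (ev z (w j))%:R)) ^+ 2)); last first.
    by move=> w; rewrite Ex_sum.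
  apply: le_trans (@second_moment _ m (fun w => Ex (fun z => (ev z w)%:R)) W0 _) _ => //.
  rewrite -Ex_swap -/P lerD2r ler_wpM2l // /P Ex_swap -ExZ; apply: le_Ex => w.
  by rewrite expr2 ler_wpM2r.
have := ler_wpM2l m0 H1; have := ler_wpM2l (exprn_ge0 2 m0) H2.
set a := Ex _; set b := Ex _ => Hb Ha.
apply: (le_trans (lerD Ha Hb)); rewrite le_eqVlt; apply/orP; left; apply/eqP.
by ring.
Qed.

Lemma pr_collisions_ge (theta : R) : 0 < theta -> 20 * (m%:R ^+ 2 * P) <= theta ->
  pr R (fun s => theta <= collisions s) <= 20^-1.
Proof.
move=> t0 Pt; apply: le_trans (markov collisions_ge0 t0) _.
rewrite Ex_collisions ler_pdivrMr //; lra.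
Qed.

Lemma pr_collisions_lt (theta : R) : 0 < theta -> 2 * theta <= m%:R ^+ 2 * P ->
  (forall z, Ex (fun w => (ev z w)%:R) <= c) ->
  (forall w, Ex (fun z => (ev z w)%:R) <= c) ->
  80 * (1 + 2 * m%:R * c) <= m%:R ^+ 2 * P ->
  pr R (fun s => ~~ (theta <= collisions s)) <= 20^-1.
Proof.
move=> t0 Pt dZ dW big; set mu := m%:R ^+ 2 * P in Pt big *.
have mu0 : 0 < mu by lra.
(* Chebyshev: a count below theta <= mu / 2 deviates by at least mu / 2, and the variance is at most
   mu (1 + 2 m c) <= mu^2 / 80, that is 1/20 of mu^2 / 4. *)
apply: (@le_trans _ _ (pr R (fun s => mu ^+ 2 / 4 <= (collisions s - mu) ^+ 2))).
  apply: le_pr => s; rewrite -ltNge => H; have := collisions_ge0 s => C0.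
  have : mu / 2 <= mu - collisions s by lra.
  move: (collisions s) => x H'; nra.
apply: le_trans (markov (fun s => sqr_ge0 _) _) _.
  by rewrite divr_gt0 // exprn_gt0.
have -> : Ex (fun s => (collisions s - mu) ^+ 2) =
    Ex (fun s => collisions s ^+ 2) - mu ^+ 2.
  transitivity (Ex (fun s => collisions s ^+ 2 + (mu ^+ 2 - 2 * mu * collisions s))).
    by apply: eq_Ex => s; ring.
  rewrite ExD ExB ExZ Ex_collisions -/mu Ex_cst; first by ring.
  by rewrite card_prod muln_gt0 !card_ffun_gt0.
rewrite ler_pdivrMr ?divr_gt0 ?exprn_gt0 //.
have := Ex_collisions_sq dZ dW; rewrite -/mu.
have -> : 2 * m%:R ^+ 3 * c * P = 2 * m%:R * c * mu by rewrite /mu; ring.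
have : 80 * (1 + 2 * m%:R * c) * mu <= mu * mu by rewrite ler_wpM2r // ltW.
set y := Ex _; lra.
Qed.

End Collisions.
End SecondMoment.

(** * Folding the cube along a binning *)

Section Folding.
Variables (R : realType) (n k : nat) (L : finType).
Hypothesis L0 : (0 < #|L|)%N.
Implicit Types (u h f g : boolfun n) (psi : {ffun 'I_n -> L * bool}).
Implicit Types (kappa : {ffun 'I_k -> L * bool}) (z : {ffun L -> bool}).

(* A variable in bin (b, c) is given the value z_b xor c: over random psi the
   point is uniform for each fixed z, and over random z the variables in
   distinct coarse bins are independent. *)
Definition fold_pt psi z : cube n := [ffun v => z (psi v).1 (+) (psi v).2].
Definition label kappa z : cube k := [ffun t => z (kappa t).1 (+) (kappa t).2].
Definition coarse_inj kappa := injective (fst \o kappa).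

Definition folded_dist psi u h : R :=
  Ex (fun z => (u (fold_pt psi z) != h (fold_pt psi z))%:R).

Lemma fold_gt0 : (0 < #|{ffun L -> bool}|)%N.
Proof. by apply: card_ffun_gt0; rewrite card_bool. Qed.

(** After expanding F in indicators the expectation factors over I: by injectivity a coordinate is
    used by at most one t, and contributes 1/2 if used and 1 if not. *)
Lemma Ex_restrict (I : finType) (f : 'I_k -> I) (c : 'I_k -> bool) (F : cube k -> R) :
  injective f ->
  Ex (fun z : {ffun I -> bool} => F [ffun t => z (f t) (+) c t]) = Ex F.
Proof.
move=> finj.
have delta (y : cube k) : F y = \sum_a F a * \prod_t (y t == a t)%:R.
  rewrite (bigD1 y) //= [X in _ * X]big1 => [|t _]; last by rewrite eqxx.
  rewrite mulr1 big1 ?addr0 // => a ay.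
  have [t yat] : exists t, y t != a t.
    apply/existsP; apply: contraNT ay => /existsPn H; apply/eqP/ffunP => t.
    by apply/esym/eqP/negPn.
  by rewrite (bigD1 t) //= (negPf yat) mul0r mulr0.
rewrite (eq_Ex (fun z : {ffun I -> bool} => delta [ffun t => z (f t) (+) c t])).
rewrite Ex_sum /Ex mulr_suml; apply: eq_bigr => a _.
rewrite -/(Ex _) ExZ; congr (_ * _).
pose G i (b : bool) : R :=
  \prod_(t | f t == i) (b (+) c t == a t)%:R.
transitivity (Ex (fun z : {ffun I -> bool} => \prod_i G i (z i))).
  apply: eq_Ex => z; rewrite (partition_big f predT) //=; apply: eq_bigr => i _.
  by apply: eq_bigr => t /eqP<-; rewrite ffunE.
rewrite Ex_prod card_ffun card_bool card_ord natrX -[k in _ ^+ k]card_ord -exprVn -prodr_const.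
rewrite [RHS](partition_big f predT) //=; apply: eq_bigr => i _.
have [t0 /eqP ft0|Hno] := pickP (fun t => f t == i); last first.
  rewrite [RHS]big_pred0 // -[RHS](Ex_cst 1 (_ : (0 < #|{: bool}|)%N)) ?card_bool //.
  by apply: eq_Ex => b; rewrite /G big_pred0.
have t0only t : (f t == i) = (t == t0) by rewrite -ft0 (inj_eq finj).
rewrite (big_pred1 t0) //; rewrite /Ex card_bool big_bool /G !(big_pred1 t0) //=.
by case: (c t0); case: (a t0); rewrite /= ?addr0 ?add0r mul1r.
Qed.

Lemma Ex_label kappa (F : cube k -> R) : coarse_inj kappa ->
  Ex (fun z => F (label kappa z)) = Ex F.
Proof. exact: (@Ex_restrict _ (fst \o kappa) (fun t => (kappa t).2)). Qed.

Lemma Ex_subcube (e : 'I_k -> 'I_n) (F : cube k -> R) : injective e ->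
  Ex (fun x : cube n => F [ffun t => x (e t)]) = Ex F.
Proof.
move=> einj; rewrite -(Ex_restrict (fun=> false) F einj); apply: eq_Ex => x.
by congr F; apply/ffunP => t; rewrite !ffunE addbF.
Qed.

(** For fixed z and fixed first components, the second components of psi are uniform bits, and xor
    with fixed bits is a bijection of the cube. *)
Lemma Ex_fold_pt z (F : cube n -> R) : Ex (fun psi => F (fold_pt psi z)) = Ex F.
Proof.
pose h (p : {ffun 'I_n -> L} * cube n) : {ffun 'I_n -> L * bool} :=
  [ffun v => (p.1 v, p.2 v)].
have hbij : bijective h.
  exists (fun psi => ([ffun v => (psi v).1], [ffun v => (psi v).2])) => [[b c]|psi].
    by congr (_, _); apply/ffunP => v; rewrite !ffunE.
  by apply/ffunP => v; rewrite !ffunE -surjective_pairing.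
rewrite -(Ex_bij _ hbij) Ex_pair -[RHS](@Ex_cst R {ffun 'I_n -> L} (Ex F)); last first.
  exact: card_ffun_gt0.
apply: eq_Ex => b.
pose s (c : cube n) : cube n := [ffun v => z (b v) (+) c v].
rewrite -(@Ex_bij _ _ _ s F).
  by apply: eq_Ex => c; congr F; apply/ffunP => v; rewrite !ffunE.
by apply: inv_bij => c; apply/ffunP => v; rewrite !ffunE addbA addbb.
Qed.

Lemma folded_dist_ge0 psi u h : 0 <= folded_dist psi u h.
Proof. exact: Ex_ge0. Qed.

Lemma folded_dist_markov u h (b : R) : 0 < b -> dist R u h <= b ->
  pr R (fun psi => 20 * b <= folded_dist psi u h) <= 20^-1.
Proof.
move=> b0 uh; apply: le_trans (markov (fun psi => folded_dist_ge0 _ _ _) _) _.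
  by rewrite mulr_gt0.
rewrite /folded_dist Ex_swap.
rewrite (eq_Ex (fun z => Ex_fold_pt z (fun x => (u x != h x)%:R))).
rewrite Ex_cst ?fold_gt0 // -distE ler_pdivrMr ?mulr_gt0 //; lra.
Qed.

Lemma folded_dist_triangle psi u h h' :
  folded_dist psi u h' <= folded_dist psi u h + folded_dist psi h h'.
Proof.
rewrite -ExD; apply: le_Ex => z; rewrite -natrD ler_nat.
by case: (u _); case: (h _); case: (h' _).
Qed.

(** Variables in distinct coarse bins receive independent uniform bits, so for juntas on such
    variables folding is exact and no Markov factor is lost. *)
Lemma folded_dist_junta psi (e : 'I_k -> 'I_n) h h' : injective e ->
  coarse_inj [ffun t => psi (e t)] ->
  depends_within [set e t | t : 'I_k] h -> depends_within [set e t | t : 'I_k] h' ->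
  folded_dist psi h h' = dist R h h'.
Proof.
move=> einj cinj hE h'E.
(* The value outside the image of e is arbitrary: h and h' only read variables in that image. *)
pose ext (y : cube k) : cube n :=
  [ffun v => if [pick t | e t == v] is Some t then y t else false].
have extE (x : cube n) u : depends_within [set e t | t : 'I_k] u ->
    u x = u (ext [ffun t => x (e t)]).
  move=> uE; apply: uE => v /imsetP[t _ ->]; rewrite ffunE.
  by case: pickP => [t' /eqP/einj->|/(_ t)]; rewrite ?eqxx // ffunE.
rewrite distE.
pose F (y : cube k) : R := (h (ext y) != h' (ext y))%:R.
transitivity (Ex F); last first.
  rewrite -(Ex_subcube F einj); apply: eq_Ex => x.
  by rewrite /F -(extE x h hE) -(extE x h' h'E).
rewrite -(Ex_label F cinj); apply: eq_Ex => z; rewrite /F.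
have -> : label [ffun t => psi (e t)] z = [ffun t => fold_pt psi z (e t)].
  by apply/ffunP => t; rewrite !ffunE.
by rewrite -(extE _ h hE) -(extE _ h' h'E).
Qed.

(** The event counted by the isomorphism test: two samples that agree when [kappa t] is matched with
    [kappa' t], yet witness a disagreement of f and g. *)
Definition meet psi psi' kappa kappa' f g z z' : bool :=
  (label kappa z == label kappa' z') && (f (fold_pt psi z) != g (fold_pt psi' z')).

Definition mismatch psi psi' kappa kappa' f g : R :=
  Ex (fun z => Ex (fun z' => (meet psi psi' kappa kappa' f g z z')%:R)).

Lemma Ex_label_eq kappa y : coarse_inj kappa ->
  Ex (fun z => (label kappa z == y)%:R : R) = 2^-1 ^+ k.
Proof.
move=> /(Ex_label (fun y' => (y' == y)%:R)) ->.
rewrite /Ex (bigD1 y) //= eqxx big1 => [|y' /negPf->//].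
by rewrite addr0 mul1r card_ffun card_bool card_ord natrX exprVn.
Qed.

Section Pair.
Variables (psi psi' : {ffun 'I_n -> L * bool}) (kappa kappa' : {ffun 'I_k -> L * bool}).
Hypotheses (kinj : coarse_inj kappa) (kinj' : coarse_inj kappa').

Lemma meet_degl f g z :
  Ex (fun z' => (meet psi psi' kappa kappa' f g z z')%:R) <= 2^-1 ^+ k :> R.
Proof.
rewrite -(Ex_label_eq (label kappa z) kinj'); apply: le_Ex => z'.
by rewrite /meet eq_sym; case: (_ == _) => //=; case: (_ == _).
Qed.

Lemma meet_degr f g z' :
  Ex (fun z => (meet psi psi' kappa kappa' f g z z')%:R) <= 2^-1 ^+ k :> R.
Proof.
rewrite -(Ex_label_eq (label kappa' z') kinj); apply: le_Ex => z.
by rewrite /meet; case: (label _ _ == _) => //=; case: (_ == _).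
Qed.

Let side f h : Ex (fun z => Ex (fun z' => ((label kappa z == label kappa' z') &&
    (f (fold_pt psi z) != h (fold_pt psi z)))%:R)) = 2^-1 ^+ k * folded_dist psi f h.
Proof.
rewrite -ExZ; apply: eq_Ex => z; rewrite -(Ex_label_eq (label kappa z) kinj') -ExZr.
by apply: eq_Ex => z'; rewrite eq_sym -natrM mulnb.
Qed.

Let side' g h : Ex (fun z => Ex (fun z' => ((label kappa z == label kappa' z') &&
    (g (fold_pt psi' z') != h (fold_pt psi' z')))%:R)) = 2^-1 ^+ k * folded_dist psi' g h.
Proof.
rewrite Ex_swap -ExZ; apply: eq_Ex => z'.
rewrite -(Ex_label_eq (label kappa' z') kinj) -ExZr.
by apply: eq_Ex => z; rewrite -natrM mulnb.
Qed.

(** A disagreement of f and g carries over to h and h' unless a replacement fails at its own point;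
    each failure is weighted by the chance 2^-k that the other sample has the same label. *)
Lemma mismatch_le f g h h' :
  mismatch psi psi' kappa kappa' f g <= mismatch psi psi' kappa kappa' h h' +
    2^-1 ^+ k * (folded_dist psi f h + folded_dist psi' g h').
Proof.
rewrite mulrDr -side -side' -!ExD; apply: le_Ex => z; rewrite -!ExD.
apply: le_Ex => z'; rewrite /meet -!natrD ler_nat.
case: (label _ _ == _) => //=.
by case: (f _); case: (g _); case: (h _); case: (h' _).
Qed.

Lemma mismatch0 h h' : (forall z z', label kappa z = label kappa' z' ->
    h (fold_pt psi z) = h' (fold_pt psi' z')) ->
  mismatch psi psi' kappa kappa' h h' = 0.
Proof.
move=> H; rewrite /mismatch /Ex big1 ?mul0r // => z _; rewrite big1 ?mul0r // => z' _.
by rewrite /meet; case: eqP => //= /H->; rewrite eqxx.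
Qed.

Let section_of (J : {set 'I_n}) (p : {ffun 'I_n -> L * bool}) (c : {ffun 'I_k -> L * bool})
    h : coarse_inj c -> (k <= n)%N -> {in J &, injective p} -> J \subset pre p (bins c) ->
    depends_within J h ->
  exists (G : cube k -> bool) (a : 'I_k -> 'I_n), [/\ injective a,
    forall z, h (fold_pt p z) = G (label c z) &
    forall x : cube n, h x = G [ffun t => x (a t)]].
Proof.
move=> cinj kn pinj Jsub hJ.
have c_inj : injective c by move=> t t' tt; apply: cinj; rewrite /= tt.
(* S indexes the bins of c occupied by J; the remaining indices get arbitrary distinct variables,
   which lie outside J. The default in q is never taken on S. *)
pose S := [set t | [exists v in J, p v == c t]].
have SP t : t \in S -> exists2 v, v \in J & p v = c t.
  by rewrite inE => /exists_inP[v vJ /eqP]; exists v.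
pose q t := odflt (widen_ord kn t) [pick v in J | p v == c t].
have qP t : t \in S -> q t \in J /\ p (q t) = c t.
  move=> /SP[v vJ pv]; rewrite /q; case: pickP => [v' /andP[v'J /eqP]//|/(_ v)].
  by rewrite vJ pv eqxx.
have [a ainj aE] : exists2 a : 'I_k -> 'I_n, injective a & {in S, a =1 q}.
  apply: partial_injection_extension => // t t' /qP[_ pt] /qP[_ pt'] qq.
  by apply: c_inj; rewrite -pt -pt' qq.
have JP v : v \in J -> exists2 t, a t = v & c t = p v.
  move=> vJ; have := subsetP Jsub v vJ; rewrite inE => /imsetP[t _ pv].
  have tS : t \in S by rewrite inE; apply/exists_inP; exists v; rewrite ?pv.
  exists t; rewrite ?aE //; have [qJ pq] := qP t tS.
  by apply: pinj => //; rewrite pq.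
pose ext (y : cube k) : cube n :=
  [ffun v => if [pick t | a t == v] is Some t then y t else false].
have extE y t : ext y (a t) = y t.
  by rewrite ffunE; case: pickP => [t' /eqP/ainj->|/(_ t)] //; rewrite eqxx.
exists (fun y => h (ext y)), a; split=> // [z|x]; apply: hJ => v /JP[t <- ct].
  by rewrite extE !ffunE ct.
by rewrite extE ffunE.
Qed.

(* The permutation sends the variable of h' in the bin kappa' t to the variable
   of h in the bin kappa t. *)
Lemma mismatch_iso (J J' : {set 'I_n}) h h' : (k <= n)%N ->
  {in J &, injective psi} -> J \subset pre psi (bins kappa) -> depends_within J h ->
  {in J' &, injective psi'} -> J' \subset pre psi' (bins kappa') -> depends_within J' h' ->
  exists s : {perm 'I_n}, dist R h (relabel h' s) =
    2 ^+ k * mismatch psi psi' kappa kappa' h h'.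
Proof.
move=> kn pinj Jsub hJ pinj' Jsub' hJ'.
have [G [a [ainj hG hGa]]] := section_of kinj kn pinj Jsub hJ.
have [G' [a' [ainj' hG' hGa']]] := section_of kinj' kn pinj' Jsub' hJ'.
pose p v := if [pick t | a' t == v] is Some t then a t else v.
have pE t : p (a' t) = a t.
  by rewrite /p; case: pickP => [t' /eqP/ainj'->|/(_ t)] //; rewrite eqxx.
have [|s sE] := @perm_extension _ [set a' t | t : 'I_k] p.
  by move=> v v' /imsetP[t _ ->] /imsetP[t' _ ->]; rewrite !pE => /ainj->.
exists s.
pose F y : R := (G y != G' y)%:R.
transitivity (Ex F).
  rewrite distE -(Ex_subcube F ainj); apply: eq_Ex => x; rewrite /F hGa.
  rewrite /relabel ffunE hGa'; congr ((_ != G' _)%:R); apply/ffunP => t.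
  by rewrite !ffunE sE ?imset_f // pE.
have two : 2 ^+ k * 2^-1 ^+ k = 1 :> R.
  by rewrite -exprMn divff ?expr1n ?pnatr_eq0.
suff -> : mismatch psi psi' kappa kappa' h h' = 2^-1 ^+ k * Ex F by rewrite mulrA two mul1r.
rewrite -(Ex_label F kinj) -ExZ; apply: eq_Ex => z.
rewrite -(Ex_label_eq (label kappa z) kinj') -ExZr; apply: eq_Ex => z'.
rewrite /meet hG hG' /F -natrM mulnb eq_sym.
by case: eqP => //= ->.
Qed.

End Pair.
End Folding.

(** * The isomorphism test *)

Section Projections.
Variables (R : realType) (T U : finType).

Lemma pr_fst (P : pred T) : (0 < #|U|)%N -> pr R (fun p : T * U => P p.1) = pr R P.
Proof. by move=> U0; rewrite /pr Ex_pair; apply: eq_Ex => x /=; rewrite Ex_cst. Qed.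

Lemma pr_snd (P : pred U) : (0 < #|T|)%N -> pr R (fun p : T * U => P p.2) = pr R P.
Proof. by move=> T0; rewrite /pr Ex_pair Ex_swap; apply: eq_Ex => x /=; rewrite Ex_cst. Qed.

End Projections.

Section IsoTest.
Variables (R : realType) (n k : nat) (L : finType).
Hypothesis L0 : (0 < #|L|)%N.
Variables (r q m : nat) (theta : R).
Implicit Types (f g h : boolfun n).

Let B := (L * bool)%type.
Let B0 : (0 < #|{: B}|)%N.
Proof. by rewrite card_prod card_bool muln_gt0 L0. Qed.

Definition foldbatch : finType :=
  ({ffun 'I_m -> {ffun L -> bool}} * {ffun 'I_m -> {ffun L -> bool}})%type.
Definition icoins : finType :=
  ((jcoins n B r q * jcoins n B r q) * {ffun 'I_r -> foldbatch})%type.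

Definition ipass f g (psi psi' : {ffun 'I_n -> B}) (kappa kappa' : {ffun 'I_k -> B})
    (w : {ffun 'I_r -> foldbatch}) : bool :=
  (2 * #|[set i | (theta <= collisions R (meet psi psi' kappa kappa' f g) (w i))%R]| < r)%N.

(* Without the junta tests, flipping the bit of a bin would make a function
   look isomorphic to itself with some variables negated. *)
Definition iaccept f g (om : icoins) : bool :=
  [exists kappa : {ffun 'I_k -> B}, exists kappa' : {ffun 'I_k -> B},
    [&& jpass fst f om.1.1 kappa, jpass fst g om.1.2 kappa' &
        ipass f g om.1.1.1 om.1.2.1 kappa kappa' om.2]].

Let cube0 : (0 < #|{ffun L -> bool}|)%N := fold_gt0 L.
Let batch0 : (0 < #|foldbatch|)%N.
Proof. by rewrite card_prod muln_gt0; apply/andP; split; apply: card_ffun_gt0. Qed.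
Let j0 : (0 < #|jcoins n B r q|)%N := jcoins_gt0 n B0 r q.
Let jj0 : (0 < #|((jcoins n B r q * jcoins n B r q)%type : finType)|)%N.
Proof. by rewrite card_prod muln_gt0 j0. Qed.
Let batches0 : (0 < #|{ffun 'I_r -> foldbatch}|)%N.
Proof. exact: card_ffun_gt0. Qed.
Let jb0 : (0 < #|{ffun 'I_r -> {ffun 'I_q -> jsample n B}}|)%N.
Proof. by do 2!apply: card_ffun_gt0; apply: jsample_gt0. Qed.

Variables (tau delta beta D1 : R).
Hypothesis q_le : q%:R * ((3 / 4) ^+ k * tau) <= 20^-1.
Hypothesis q_ge : 19 <= q%:R * ((3 / 4) ^+ k / 4 * delta).
Hypothesis theta0 : 0 < theta.
Hypothesis beta0 : 0 < beta.
Hypothesis theta_ge : 20 * (m%:R ^+ 2 * (2^-1 ^+ k * (40 * beta))) <= theta.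
Hypothesis theta_le : 2 * theta <= m%:R ^+ 2 * (2^-1 ^+ k * D1).
Hypothesis m_ge : 80 * (1 + 2 * m%:R * 2^-1 ^+ k) <= m%:R ^+ 2 * (2^-1 ^+ k * D1).

Let half_ge0 : 0 <= 2^-1 ^+ r :> R.
Proof. by rewrite exprn_ge0 // invr_ge0. Qed.

(** The bins of the variables e and e' serve as the accepted tuples. As h and h' are the same
    function H of the matched variables, all mismatch comes from replacing f by h and g by h', at
    most 2^-k * 40 beta outside the exceptional event. *)
Lemma iaccept_complete f g h h' (e e' : 'I_k -> 'I_n) (H : cube k -> bool) :
  injective e -> injective e' ->
  infl R f [set e t | t : 'I_k] <= tau -> infl R g [set e' t | t : 'I_k] <= tau ->
  (forall x : cube n, h x = H [ffun t => x (e t)]) ->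
  (forall x : cube n, h' x = H [ffun t => x (e' t)]) ->
  dist R f h <= beta -> dist R g h' <= beta ->
  pr R (fun om => ~~ iaccept f g om) <=
    2 * (k%:R ^+ 2 * collprob R (fst : B -> L) + 2^-1 ^+ r) + 10^-1 + 2^-1 ^+ r.
Proof.
move=> einj einj' If Ig hH hH' fh gh.
pose kap (e0 : 'I_k -> 'I_n) (om : jcoins n B r q) := [ffun t => om.1 (e0 t)].
pose P1 u e0 (om : jcoins n B r q) := ~~ jpass fst u om (kap e0 om).
pose P2 u v (om : jcoins n B r q) := 20 * beta <= folded_dist R om.1 u v.
pose P (x : jcoins n B r q * jcoins n B r q) :=
  (P1 f e x.1 || P1 g e' x.2) || (P2 f h x.1 || P2 g h' x.2).
have pr1 u e0 : injective e0 -> infl R u [set e0 t | t : 'I_k] <= tau ->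
    pr R (P1 u e0) <= k%:R ^+ 2 * collprob R (fst : B -> L) + 2^-1 ^+ r.
  by move=> e0inj Iu; apply: (@jpass_complete R n k B L fst B0 r q u tau).
have pr2 u v : dist R u v <= beta -> pr R (P2 u v) <= 20^-1.
  move=> uv; rewrite /P2 (pr_fst R (fun psi => 20 * beta <= folded_dist R psi u v)) //.
  exact: folded_dist_markov.
have prP : pr R P <= 2 * (k%:R ^+ 2 * collprob R (fst : B -> L) + 2^-1 ^+ r) + 10^-1.
  apply: le_trans (prU _ _ _) _.
  have := prU R (fun x : jcoins n B r q * jcoins n B r q => P1 f e x.1) (fun x => P1 g e' x.2).
  rewrite pr_fst // pr_snd //.
  have := prU R (fun x : jcoins n B r q * jcoins n B r q => P2 f h x.1) (fun x => P2 g h' x.2).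
  rewrite pr_fst // pr_snd //.
  have := pr1 f e einj If; have := pr1 g e' einj' Ig.
  have := pr2 f h fh; have := pr2 g h' gh; lra.
apply: (@le_trans _ _ (pr R P + 2^-1 ^+ r)); last by rewrite lerD2r.
apply: pr_pair_le => // -[om om'] /=.
rewrite /P !negb_or /P1 /P2 !negbK /= -!ltNge => /andP[/andP[jf jg] /andP[Nf Ng]].
have /andP[/injectiveP kinj _] := jf; have /andP[/injectiveP kinj' _] := jg.
pose ev := meet om.1 om'.1 (kap e om) (kap e' om') f g.
apply: le_trans (@majority R _ r (fun s => theta <= collisions R ev s) batch0 _).
  apply: le_pr => w; apply: contraR; rewrite -ltnNge => Hw.
  by apply/existsP; exists (kap e om); apply/existsP; exists (kap e' om'); apply/and3P; split.
apply: (@pr_collisions_ge _ _ _ _ _ cube0 cube0) => //.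
apply: le_trans theta_ge; rewrite ler_pM2l // ler_wpM2l ?exprn_ge0 //.
apply: le_trans (mismatch_le R _ _ kinj kinj' f g h h') _.
rewrite (@mismatch0 R) ?add0r => [|z z' zz].
  rewrite ler_wpM2l ?exprn_ge0 ?invr_ge0 //; lra.
rewrite hH hH'; congr H; apply/ffunP => t.
by have /ffunP/(_ t) := zz; rewrite !ffunE.
Qed.

(** J keeps those variables of e that lie in the passing bins. There infl h J <= beta + delta + 2
    beta <= 4 beta, which gives 5 beta in distance and 20 beta + 4 beta after folding. *)
Let restricted_junta u h (e : 'I_k -> 'I_n) (psi : {ffun 'I_n -> B}) (kappa : {ffun 'I_k -> B}) :
  injective e -> delta <= beta -> infl R u [set e t | t : 'I_k] <= beta ->
  depends_within [set e t | t : 'I_k] h -> dist R u h <= beta ->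
  separated fst psi [set e t | t : 'I_k] -> folded_dist R psi u h < 20 * beta ->
  infl R u (pre psi (bins kappa)) < delta ->
  exists (h'' : boolfun n) (J : {set 'I_n}),
    [/\ {in J &, injective psi}, J \subset pre psi (bins kappa), depends_within J h'',
        dist R u h'' <= 5 * beta & folded_dist R psi u h'' <= 24 * beta].
Proof.
move=> einj db Iu hE uh sep Nu Ik.
set E := [set e t | t : 'I_k]; set J := E :&: pre psi (bins kappa).
have [h'' h''J hh''] := infl_junta R h J.
have JE : J \subset E by apply: subsetIl.
have Ih : infl R h J <= 4 * beta.
  have := infl_le_dist R h u J; have := infl_setI R u E (pre psi (bins kappa)).
  rewrite -/J dist_sym; lra.
exists h'', J; split=> //.
- by move=> v v' /(subsetP JE) vE /(subsetP JE) v'E; apply: (separated_inj sep).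
- exact: subsetIr.
- have := dist_triangle R u h h''; lra.
apply: le_trans (folded_dist_triangle _ _ _ h _) _.
rewrite (@folded_dist_junta R n k L psi e h h'') //.
- lra.
- move=> t t' /=; rewrite !ffunE => tt; apply: einj.
  by move/dinjectiveP: sep; apply; rewrite ?imset_f.
exact: depends_within_sub h''J.
Qed.

(** For tuples passing both junta tests, [mismatch_iso] relates the mismatch to the distance of f to
    a relabelled g, so the mismatch is at least 2^-k * D1. Here 58 = 2 * 24 + 2 * 5 counts the
    folded and the unfolded replacements. The last term is a union bound over all pairs of
    tuples. *)
Lemma iaccept_sound f g h h' (e e' : 'I_k -> 'I_n) : (k <= n)%N ->
  injective e -> injective e' -> delta <= beta ->
  infl R f [set e t | t : 'I_k] <= beta -> infl R g [set e' t | t : 'I_k] <= beta ->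
  depends_within [set e t | t : 'I_k] h -> depends_within [set e' t | t : 'I_k] h' ->
  dist R f h <= beta -> dist R g h' <= beta ->
  (forall s, 58 * beta + D1 < dist R f (relabel g s)) ->
  pr R (iaccept f g) <=
    2 * (#|{: B}|%:R ^+ k * 2^-1 ^+ r + k%:R ^+ 2 * collprob R (fst : B -> L)) + 10^-1 +
    #|{: B}|%:R ^+ (2 * k) * 2^-1 ^+ r.
Proof.
move=> kn einj einj' db If Ig hE hE' fh gh far.
pose P0 u (om : jcoins n B r q) := [exists kappa : {ffun 'I_k -> B},
    jpass fst u om kappa && (delta <= infl R u (pre om.1 (bins kappa)))].
pose P1 (e0 : 'I_k -> 'I_n) (om : jcoins n B r q) :=
  ~~ separated fst om.1 [set e0 t | t : 'I_k].
pose P2 u v (om : jcoins n B r q) := 20 * beta <= folded_dist R om.1 u v.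
pose Q u v e0 om := P0 u om || (P1 e0 om || P2 u v om).
pose P (x : jcoins n B r q * jcoins n B r q) := Q f h e x.1 || Q g h' e' x.2.
have prQ u v e0 : injective e0 -> dist R u v <= beta ->
    pr R (Q u v e0) <= #|{: B}|%:R ^+ k * 2^-1 ^+ r +
      k%:R ^+ 2 * collprob R (fst : B -> L) + 20^-1.
  move=> e0inj uv; apply: le_trans (prU _ _ _) _; rewrite -addrA.
  apply: lerD; first exact: (@jpass_sound R n k B L fst B0 r q u delta).
  apply: le_trans (prU _ _ _) _; apply: lerD.
    rewrite /P1 (pr_fst R (fun psi => ~~ separated fst psi [set e0 t | t : 'I_k])) //.
    apply: le_trans (pr_not_separated _ _ B0 _) _.
    by rewrite card_imset // card_ord.
  rewrite /P2 (pr_fst R (fun psi => 20 * beta <= folded_dist R psi u v)) //.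
  exact: folded_dist_markov.
have prP : pr R P <= 2 * (#|{: B}|%:R ^+ k * 2^-1 ^+ r +
    k%:R ^+ 2 * collprob R (fst : B -> L)) + 10^-1.
  apply: le_trans (prU _ _ _) _; rewrite pr_fst // pr_snd //.
  have := prQ f h e einj fh; have := prQ g h' e' einj' gh; lra.
apply: (@le_trans _ _ (pr R P + #|{: B}|%:R ^+ (2 * k) * 2^-1 ^+ r)); last by rewrite lerD2r.
apply: pr_pair_le => // [|[om om'] /=]; first by rewrite mulr_ge0 // exprn_ge0.
rewrite /P /= !negb_or /P2 -!ltNge.
case/andP=> /and3P[nP0 sepf Nf] /and3P[nP0' sepg Ng].
move: sepf sepg; rewrite /P1 !negbK => sepf sepg.
apply: (@le_trans _ _ (pr R (fun w => [exists p : {ffun 'I_k -> B} * {ffun 'I_k -> B},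
    [&& jpass fst f om p.1, jpass fst g om' p.2 & ipass f g om.1 om'.1 p.1 p.2 w]]))).
  apply: le_pr => w /existsP[kappa /existsP[kappa' H]].
  by apply/existsP; exists (kappa, kappa').
apply: le_trans (pr_exists _ _) _.
have -> : #|{: B}|%:R ^+ (2 * k) * 2^-1 ^+ r =
    \sum_(p : {ffun 'I_k -> B} * {ffun 'I_k -> B}) 2^-1 ^+ r :> R.
  have cardp : #|{: {ffun 'I_k -> B} * {ffun 'I_k -> B}}| = (#|{: B}| ^ (2 * k))%N.
    by rewrite card_prod !card_ffun !card_ord -expnD addnn mul2n.
  by rewrite sumr_const cardp -[RHS]mulr_natl natrX.
apply: ler_sum => -[kappa kappa'] _ /=.
case: (boolP (jpass fst f om kappa)) => [jf|_]; last first.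
  by rewrite /pr /Ex big1 ?mul0r.
case: (boolP (jpass fst g om' kappa')) => [jg|_]; last first.
  by rewrite /pr /Ex big1 ?mul0r.
have If' : infl R f (pre om.1 (bins kappa)) < delta.
  by rewrite ltNge; apply: contra nP0 => H; apply/existsP; exists kappa; rewrite jf.
have Ig' : infl R g (pre om'.1 (bins kappa')) < delta.
  by rewrite ltNge; apply: contra nP0' => H; apply/existsP; exists kappa'; rewrite jg.
have /andP[/injectiveP kinj _] := jf; have /andP[/injectiveP kinj' _] := jg.
have [h2 [J [Jinj Jsub h2J fh2 Nf2]]] := restricted_junta einj db If hE fh sepf Nf If'.
have [h2' [J' [Jinj' Jsub' h2J' gh2 Ng2]]] := restricted_junta einj' db Ig hE' gh sepg Ng Ig'.
pose ev := meet om.1 om'.1 kappa kappa' f g.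
apply: le_trans (@majority R _ r (fun s => ~~ (theta <= collisions R ev s)) batch0 _).
  by apply: le_pr => w; exact: minority_complement.
have large : m%:R ^+ 2 * (2^-1 ^+ k * D1) <= m%:R ^+ 2 *
    mismatch R om.1 om'.1 kappa kappa' f g.
  rewrite ler_wpM2l ?exprn_ge0 //.
  have [s Hs] := mismatch_iso R kinj kinj' kn Jinj Jsub h2J Jinj' Jsub' h2J'.
  have two : 2^-1 ^+ k * 2 ^+ k = 1 :> R.
    by rewrite -exprMn mulVf ?expr1n ?pnatr_eq0.
  have cancel (x : R) : 2 ^+ k * (2^-1 ^+ k * x) = x.
    by rewrite mulrA [2 ^+ k * _]mulrC two mul1r.
  have := mismatch_le R om.1 om'.1 kinj kinj' h2 h2' f g.
  have fs (psi : {ffun 'I_n -> B}) u v : folded_dist R psi u v = folded_dist R psi v u.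
    by apply: eq_Ex => z; rewrite eq_sym.
  rewrite (fs _ h2) (fs _ h2') => mm.
  have ds : dist R h2 (relabel h2' s) <=
      2 ^+ k * mismatch R om.1 om'.1 kappa kappa' f g + 48 * beta.
    rewrite Hs; have := ler_wpM2l (exprn_ge0 k (ler0n R 2)) mm.
    by rewrite mulrDr cancel; lra.
  have := far s; have := dist_triangle R f h2 (relabel g s).
  have := dist_triangle R h2 (relabel h2' s) (relabel g s).
  rewrite dist_relabel (dist_sym R h2' g) => t1 t2 t3.
  have : D1 <= 2 ^+ k * mismatch R om.1 om'.1 kappa kappa' f g by lra.
  have cancel' (x : R) : 2^-1 ^+ k * (2 ^+ k * x) = x by rewrite mulrA two mul1r.
  by move=> H; rewrite -[leRHS]cancel' ler_wpM2l // exprn_ge0 // invr_ge0.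
apply: (@pr_collisions_lt _ _ _ _ _ (2^-1 ^+ k) cube0 cube0) => //.
- exact: le_trans theta_le large.
- by move=> z; apply: meet_degl.
- by move=> z; apply: meet_degr.
exact: le_trans m_ge large.
Qed.

End IsoTest.

(** * Decision trees *)

Section Trees.
Variable n : nat.
Implicit Types (f g : boolfun n) (t : dtree n).

Definition query (onG : bool) (x : cube n) (next : bool -> dtree n) : dtree n :=
  if onG then QueryG x next else QueryF x next.

Fixpoint ask_seq (onG : bool) (xs : seq (cube n)) (next : seq bool -> dtree n) : dtree n :=
  if xs is x :: xs' then
    query onG x (fun b => ask_seq onG xs' (fun bs => next (b :: bs)))
  else next [::].

(** A nonadaptive batch: the continuation sees the whole table of answers, indexed by I. *)
Definition ask (onG : bool) (I : finType) (pt : I -> cube n)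
    (next : {ffun I -> bool} -> dtree n) : dtree n :=
  ask_seq onG (map pt (enum I))
    (fun bs => next [ffun i => nth false bs (index i (enum I))]).

Lemma ask_seqE onG xs next f g (u := if onG then g else f) :
  accepts (ask_seq onG xs next) f g = accepts (next (map u xs)) f g /\
  queries (ask_seq onG xs next) f g = (size xs + queries (next (map u xs)) f g)%N.
Proof.
elim: xs next => //= x xs IH next; rewrite /query /u.
by case: onG @u IH => u IH /=; have [-> ->] := IH (fun bs => next (u x :: bs)).
Qed.

Lemma askE onG (I : finType) (pt : I -> cube n) next f g (u := if onG then g else f) :
  accepts (ask onG pt next) f g = accepts (next [ffun i => u (pt i)]) f g /\
  queries (ask onG pt next) f g = (#|I| + queries (next [ffun i => u (pt i)]) f g)%N.
Proof.
rewrite /ask; set next' := fun bs => _.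
have [-> ->] := ask_seqE onG (map pt (enum I)) next' f g.
rewrite -/u size_map -cardE -map_comp.
suff -> : next' [seq (u \o pt) i | i <- enum I] = next [ffun i => u (pt i)] by [].
rewrite /next'; congr next; apply/ffunP => i; rewrite !ffunE (nth_map i) ?nth_index //.
- by rewrite mem_enum.
- by rewrite index_mem mem_enum.
Qed.

End Trees.

Section JuntaTestTree.
Variables (n k : nat) (B A : finType) (g0 : B -> A) (r q : nat).
Implicit Types (f g u : boolfun n) (om : jcoins n B r q).

(** The boolean separates the base point of a sample from its resampled copy, hence 2 r q queries
    for each function. *)
Definition jindex : finType := ('I_r * 'I_q * bool)%type.

Definition jpoint om (p : jindex) : cube n :=
  let s := om.2 p.1.1 p.1.2 in if p.2 then s.2.1 else jmix om.1 s.

Definition jpass_ans om (a : {ffun jindex -> bool}) (kappa : {ffun 'I_k -> B}) : bool :=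
  injectiveb (g0 \o kappa) &&
  (2 * #|[set i | [exists j, covers (om.2 i j).1 kappa &&
                             (a (i, j, true) != a (i, j, false))]]| < r)%N.

Lemma jpass_ansE om u kappa :
  jpass_ans om [ffun p => u (jpoint om p)] kappa = jpass g0 u om kappa.
Proof.
congr (_ && (2 * _ < r)%N); apply: eq_card => i; rewrite !inE.
by apply: eq_existsb => j; rewrite !ffunE.
Qed.

Definition jstop f g (om : jcoins n B r q * jcoins n B r q) : bool :=
  [exists kappa : {ffun 'I_k -> B}, jpass g0 f om.1 kappa] ||
  [exists kappa : {ffun 'I_k -> B}, jpass g0 g om.2 kappa].

Definition stop_tree (om : jcoins n B r q * jcoins n B r q) (yes no : dtree n) : dtree n :=
  ask false (jpoint om.1) (fun a => ask true (jpoint om.2) (fun a' =>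
    if [exists kappa, jpass_ans om.1 a kappa] ||
       [exists kappa, jpass_ans om.2 a' kappa] then yes else no)).

Lemma stop_treeE (om : jcoins n B r q * jcoins n B r q) yes no f g
    (t := if jstop f g om then yes else no) :
  accepts (stop_tree om yes no) f g = accepts t f g /\
  queries (stop_tree om yes no) f g = (4 * (r * q) + queries t f g)%N.
Proof.
rewrite /stop_tree.
have [-> ->] := askE false (jpoint om.1) (fun a => ask true (jpoint om.2) (fun a' =>
    if [exists kappa, jpass_ans om.1 a kappa] ||
       [exists kappa, jpass_ans om.2 a' kappa] then yes else no)) f g.
have [-> ->] := askE true (jpoint om.2) (fun a' =>
    if [exists kappa, jpass_ans om.1 [ffun p => f (jpoint om.1 p)] kappa] ||
       [exists kappa, jpass_ans om.2 a' kappa] then yes else no) f g.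
rewrite (eq_existsb (fun kappa => jpass_ansE om.1 f kappa)).
rewrite (eq_existsb (fun kappa => jpass_ansE om.2 g kappa)) -/(jstop f g om) -/t.
split=> //; rewrite addnA; congr (_ + _)%N.
by rewrite !card_prod card_bool !card_ord; lia.
Qed.

End JuntaTestTree.

Section IsoTestTree.
Variables (R : realType) (n k : nat) (L : finType) (r q m : nat) (theta : R).
Implicit Types (f g : boolfun n) (om : icoins n L r q m).

Let B : finType := (L * bool)%type.

Definition iindex : finType := ('I_r * 'I_m)%type.

Definition ipass_ans (kappa kappa' : {ffun 'I_k -> B}) (w : {ffun 'I_r -> foldbatch L m})
    (a a' : {ffun iindex -> bool}) : bool :=
  (2 * #|[set i | (theta <= \sum_j \sum_j'
     ((label kappa ((w i).1 j) == label kappa' ((w i).2 j')) &&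
      (a (i, j) != a' (i, j')))%:R)%R]| < r)%N.

Definition iso_tree om : dtree n :=
  ask false (jpoint om.1.1) (fun a => ask true (jpoint om.1.2) (fun a' =>
  ask false (fun p : iindex => fold_pt om.1.1.1 ((om.2 p.1).1 p.2)) (fun c =>
  ask true (fun p : iindex => fold_pt om.1.2.1 ((om.2 p.1).2 p.2)) (fun c' =>
  Answer [exists kappa : {ffun 'I_k -> B}, exists kappa' : {ffun 'I_k -> B},
    [&& jpass_ans fst om.1.1 a kappa, jpass_ans fst om.1.2 a' kappa' &
        ipass_ans kappa kappa' om.2 c c']])))).

Lemma iso_treeE om f g :
  accepts (iso_tree om) f g = iaccept k theta f g om /\
  queries (iso_tree om) f g = (4 * (r * q) + 2 * (r * m))%N.
Proof.
rewrite /iso_tree; do 4![rewrite (proj1 (askE _ _ _ _ _)) (proj2 (askE _ _ _ _ _))].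
split; last by rewrite /= !card_prod card_bool !card_ord; lia.
rewrite /=; apply: eq_existsb => kappa; apply: eq_existsb => kappa'.
rewrite !jpass_ansE; congr [&& _, _ & (2 * _ < r)%N].
apply: eq_card => i; rewrite !inE; congr (_ <= _); apply: eq_bigr => j _.
by apply: eq_bigr => j' _; rewrite !ffunE.
Qed.

End IsoTestTree.

(** * The loop over candidate junta sizes *)

Section Loop.
Variables (R : realType) (n : nat) (C1 C2 : nat -> finType).
Hypothesis C1_gt0 : forall k, (0 < #|C1 k|)%N.
Hypothesis C2_gt0 : forall k, (0 < #|C2 k|)%N.
Variables (T1 : forall k, C1 k -> dtree n -> dtree n -> dtree n).
Variables (T2 : forall k, C2 k -> dtree n).
Variables (f g : boolfun n) (stop : forall k, C1 k -> bool) (acc : forall k, C2 k -> bool).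
Variables (c1 c2 : nat -> nat).
Hypothesis T1E : forall k om yes no (t := if stop om then yes else no),
  accepts (@T1 k om yes no) f g = accepts t f g /\
  queries (@T1 k om yes no) f g = (c1 k + queries t f g)%N.
Hypothesis T2E : forall k om,
  accepts (@T2 k om) f g = acc om /\ queries (@T2 k om) f g = c2 k.

(** Every stage has its own coins for the stopping test and for the final test, so the verdict is
    independent of the decision to stop. *)
Fixpoint loop_coins (fuel k : nat) : finType :=
  if fuel is fuel'.+1 then ((C1 k * C2 k) * loop_coins fuel' k.+1)%type else unit.

Fixpoint loop_tree (fuel k : nat) : loop_coins fuel k -> dtree n :=
  if fuel is fuel'.+1 then
    fun om => T1 om.1.1 (T2 om.1.2) (@loop_tree fuel' k.+1 om.2)
  else fun=> Answer false.

Lemma loop_coins_gt0 fuel k : (0 < #|loop_coins fuel k|)%N.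
Proof.
elim: fuel k => [|fuel IH] k /=; first by rewrite card_unit.
by rewrite !card_prod !muln_gt0 C1_gt0 C2_gt0 IH.
Qed.

(** The bound charges a final test to every stage, although a run performs at most one. *)
Lemma loop_queries fuel k (om : loop_coins fuel k) :
  (queries (loop_tree om) f g <= \sum_(k <= j < k + fuel) (c1 j + c2 j))%N.
Proof.
elim: fuel k om => [|fuel IH] k om //=.
have [_ ->] := T1E om.1.1 (T2 om.1.2) (loop_tree om.2).
rewrite big_ltn; last by lia.
rewrite -addnA leq_add2l; case: (stop om.1.1).
  by have [_ ->] := T2E om.1.2; rewrite leq_addr.
by rewrite (leq_trans (IH _ _)) // addSnnS leq_addl.
Qed.

(** Exceeding the sum up to ks requires passing stage ks without stopping; an earlier stop only
    lowers the count. *)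
Lemma loop_queries_pr fuel k ks : (k <= ks < k + fuel)%N ->
  pr R (fun om : loop_coins fuel k => ~~ (queries (loop_tree om) f g <=
      \sum_(k <= j < ks.+1) (c1 j + c2 j))%N) <=
    pr R (fun o : C1 ks => ~~ stop o).
Proof.
elim: fuel k => [|fuel IH] k; first by move=> H; exfalso; lia.
move=> /= Hks.
have [ksk|kks] := eqVneq k ks.
  rewrite -{}ksk in Hks *.
  apply: (@le_trans _ _ (pr R (fun om : loop_coins fuel.+1 k => ~~ stop om.1.1))).
    apply: le_pr => om; apply: contra => st.
    have [_ /= ->] := T1E om.1.1 (T2 om.1.2) (loop_tree om.2); rewrite st.
    have [_ ->] := T2E om.1.2.
    by rewrite big_nat1.
  rewrite (pr_fst R (fun p : C1 k * C2 k => ~~ stop p.1)) ?loop_coins_gt0 //.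
  by rewrite (pr_fst R (fun o : C1 k => ~~ stop o)).
apply: le_trans (IH k.+1 _); last by lia.
apply: (@le_trans _ _ (pr R (fun om : loop_coins fuel.+1 k =>
    ~~ (queries (loop_tree om.2) f g <= \sum_(k.+1 <= j < ks.+1) (c1 j + c2 j))%N))).
  apply: le_pr => om; apply: contra => H.
  have [_ /= ->] := T1E om.1.1 (T2 om.1.2) (loop_tree om.2).
  rewrite big_ltn; last by lia.
  rewrite -addnA leq_add2l; case: (stop om.1.1).
    by have [_ ->] := T2E om.1.2; rewrite leq_addr.
  by rewrite (leq_trans H) // leq_addl.
rewrite (pr_snd R (fun o : loop_coins fuel k.+1 => ~~ (queries (loop_tree o) f g <=
   \sum_(k.+1 <= j < ks.+1) (c1 j + c2 j))%N)) //.
by rewrite card_prod muln_gt0 C1_gt0 C2_gt0.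
Qed.

(** Backward induction from stage ks. A stage at which the final test is reliable averages two
    acceptable errors; at any other stage stopping adds at most eta1 * 2^-j, and these terms form a
    geometric series. *)
Lemma loop_error (b : bool) (eta1 eta2 : R) fuel k ks :
  0 <= eta1 -> 0 <= eta2 -> (k <= ks < k + fuel)%N ->
  pr R (fun o : C1 ks => ~~ stop o) <= eta1 * 2^-1 ^+ ks ->
  pr R (fun o : C2 ks => acc o != b) <= eta2 ->
  (forall j, (j < ks)%N -> pr R (fun o : C2 j => acc o != b) <= eta2 \/
     pr R (fun o : C1 j => stop o) <= eta1 * 2^-1 ^+ j) ->
  pr R (fun om : loop_coins fuel k => accepts (loop_tree om) f g != b) <=
    eta2 + 2 * (eta1 * 2^-1 ^+ k).
Proof.
move=> eta10 eta20 + Hstop Hacc Hlt; elim: fuel k => [|fuel IH] k.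
  by move=> H; exfalso; lia.
move=> Hks.
have half0 j : 0 <= eta1 * 2^-1 ^+ j by rewrite mulr_ge0 // exprn_ge0 // invr_ge0.
pose W2 := pr R (fun o : C2 k => acc o != b).
pose W := pr R (fun om : loop_coins fuel k.+1 => accepts (loop_tree om) f g != b).
pose S := pr R (fun o : C1 k => stop o).
have -> : pr R (fun om : loop_coins fuel.+1 k => accepts (loop_tree om) f g != b) =
    S * W2 + (1 - S) * W.
  transitivity (Ex (fun o1 : C1 k => (stop o1)%:R * W2 + (1 - (stop o1)%:R) * W)); last first.
    by rewrite ExD !ExZr ExB Ex_cst.
  rewrite /pr Ex_pair Ex_pair; apply: eq_Ex => o1.
  case st: (stop o1) => /=.
    rewrite subrr mul0r addr0 mul1r; apply: eq_Ex => o2.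
    rewrite -[RHS](Ex_cst _ (loop_coins_gt0 fuel k.+1)); apply: eq_Ex => om.
    by have [-> _] := T1E o1 (T2 o2) (loop_tree om); rewrite st; have [->] := T2E o2.
  rewrite subr0 mul0r add0r mul1r -[RHS](Ex_cst _ (C2_gt0 k)); apply: eq_Ex => o2.
  apply: eq_Ex => om.
  by have [-> _] := T1E o1 (T2 o2) (loop_tree om); rewrite st.
have S0 : 0 <= S by apply: pr_ge0.
have S1 : S <= 1 by apply: pr_le1.
have W20 : 0 <= W2 by apply: pr_ge0.
have W21 : W2 <= 1 by apply: pr_le1.
have W0 : 0 <= W by apply: pr_ge0.
have W1 : W <= 1 by apply: pr_le1.
have hk := half0 k.
have [ksk|kks] := eqVneq k ks.
  have Ws : 1 - S <= eta1 * 2^-1 ^+ k by rewrite -prC ?C1_gt0 // ksk.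
  have W2s : W2 <= eta2 by rewrite /W2 ksk.
  have : S * W2 <= 1 * eta2 by apply: ler_pM.
  have : (1 - S) * W <= (1 - S) * 1 by apply: ler_wpM2l; lra.
  move: (eta1 * _) Ws hk => y; lra.
have [kks' ksf] := andP Hks.
have ltkks : (k < ks)%N by rewrite ltn_neqAle kks.
have : W <= eta2 + 2 * (eta1 * 2^-1 ^+ k.+1) by apply: IH; rewrite ltkks addSnnS.
rewrite exprS; set y := 2^-1 ^+ k in hk *.
have -> : 2 * (eta1 * (2^-1 * y)) = eta1 * y by field.
move=> HW; have [W2s|Ss] := Hlt k ltkks.
  have : S * W2 <= S * (eta2 + eta1 * y) by apply: ler_wpM2l => //; rewrite -/W2 in W2s; lra.
  have : (1 - S) * W <= (1 - S) * (eta2 + eta1 * y) by apply: ler_wpM2l => //; lra.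
  move: (eta1 * y) hk => x; lra.
have : S * W2 <= S * 1 by apply: ler_wpM2l.
have : (1 - S) * W <= 1 * W by apply: ler_wpM2r => //; lra.
rewrite -/S -/y in Ss; move: (eta1 * y) Ss HW hk => x; lra.
Qed.

Definition uniform_alg (T : finType) (T0 : (0 < #|T|)%N) (t : T -> dtree n) : randalg R n.
Proof.
refine (@RandAlg R n T (fun=> #|T|%:R^-1) _ _ t); first by move=> w; rewrite invr_ge0.
by rewrite sumr_const -[LHS]mulr_natl divff // pnatr_eq0 -lt0n.
Defined.

Lemma Prob_uniform (T : finType) (T0 : (0 < #|T|)%N) (t : T -> dtree n) (E : pred (dtree n)) :
  Prob (uniform_alg T0 t) E = pr R (fun w => E (t w)).
Proof.
rewrite /Prob /pr /Ex /= big_mkcond mulr_suml; apply: eq_bigr => w _.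
by case: (E (t w)); rewrite ?mul1r ?mul0r.
Qed.

End Loop.

(** * Constants *)

Lemma collprob_fst (R : realType) (L : finType) : (0 < #|L|)%N ->
  collprob R (fst : L * bool -> L) = #|L|%:R^-1.
Proof.
move=> L0; rewrite /collprob.
transitivity (Ex (fun b : L * bool => #|L|%:R^-1 : R)); last first.
  by rewrite Ex_cst // card_prod card_bool muln_gt0 L0.
apply: eq_Ex => b; rewrite Ex_pair.
transitivity (Ex (fun x : L => (b.1 == x)%:R : R)).
  by apply: eq_Ex => x; rewrite /= Ex_cst ?card_bool.
rewrite /Ex (bigD1 b.1) //= eqxx big1 ?addr0 ?mul1r // => x /negPf.
by rewrite eq_sym => ->.
Qed.

Lemma depends_within_embedding n k (e : 'I_k -> 'I_n) (h : boolfun n) : injective e ->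
  depends_within [set e t | t : 'I_k] h ->
  exists H : cube k -> bool, forall x : cube n, h x = H [ffun t => x (e t)].
Proof.
move=> einj hE.
exists (fun y => h [ffun v => if [pick t | e t == v] is Some t then y t else false]) => x.
apply: hE => v /imsetP[t _ ->]; rewrite ffunE.
by case: pickP => [t' /eqP/einj->|/(_ t)]; rewrite ?eqxx // ffunE.
Qed.

Lemma embedding_depends_within n k (e : 'I_k -> 'I_n) (h : boolfun n) (H : cube k -> bool) :
  (forall x : cube n, h x = H [ffun t => x (e t)]) ->
  depends_within [set e t | t : 'I_k] h.
Proof.
move=> hH x y xy; rewrite !hH; congr H; apply/ffunP => t.
by rewrite !ffunE xy // imset_f.
Qed.

(** Enumerate J, then its complement, and keep the first k variables. The case k = 0 is separate,
    since n may be 0 and [nth] needs a default. *)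
Lemma small_set_embedding n k (J : {set 'I_n}) : (#|J| <= k <= n)%N ->
  exists2 e : 'I_k -> 'I_n, injective e & J \subset [set e t | t : 'I_k].
Proof.
case/andP=> Jk kn.
pose s := enum J ++ enum (~: J).
have size_s : size s = n by rewrite size_cat -!cardE cardsC card_ord.
have uniq_s : uniq s.
  rewrite cat_uniq !enum_uniq andbT /=; apply/hasPn => v.
  by rewrite !mem_enum inE.
case: k Jk kn => [|k] Jk kn.
  exists (fun t : 'I_0 => False_rect _ (notF (ltn_ord t))) => [[]//|].
  by move: Jk; rewrite leqn0 cards_eq0 => /eqP->; apply: sub0set.
have i0 : 'I_n by exact: Ordinal kn.
exists (fun t : 'I_k.+1 => nth i0 s t) => [t t' /eqP|].
  rewrite nth_uniq ?size_s ?(leq_trans (ltn_ord _)) // => /eqP tt.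
  exact: val_inj.
apply/subsetP => v vJ.
have vs : (index v (enum J) < k.+1)%N.
  by apply: leq_trans Jk; rewrite cardE index_mem mem_enum.
apply/imsetP; exists (Ordinal vs) => //=.
by rewrite nth_cat index_mem mem_enum vJ nth_index // mem_enum.
Qed.

Lemma cost_factor (r a b c : nat) :
  (4 * (r * a) + (4 * (r * b) + 2 * (r * c)) = r * (4 * a + 4 * b + 2 * c))%N.
Proof. lia. Qed.

Section Constants.
Variable R : realType.

(** The 2^(4 k + 12) coarse bins absorb the cubic factor of [jpass_reject], at most 2^(3 k + 3), and
    leave 2^-(k + 9). The number of rounds pays for a union bound over pairs of k-tuples of the 2^(4
    k + 13) bins and leaves the same amount. *)
Definition coarse (k : nat) : finType := 'I_(2 ^ (4 * k + 12)).
Definition rounds (k : nat) : nat := (2 * k * (4 * k + 13) + k + 9)%N.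

Lemma rounds_le k : (rounds k <= 27 * k.+1 ^ 2)%N.
Proof. by rewrite /rounds -mulnn; nia. Qed.

Lemma coarse_gt0 k : (0 < #|coarse k|)%N.
Proof. by rewrite card_ord expn_gt0. Qed.

Lemma collprob_coarse k :
  collprob R (fst : coarse k * bool -> coarse k) = 2^-1 ^+ (4 * k + 12).
Proof. by rewrite collprob_fst ?coarse_gt0 // card_ord natrX exprVn. Qed.

Lemma card_bins k : #|{: coarse k * bool}| = (2 ^ (4 * k + 13))%N.
Proof. by rewrite card_prod card_bool card_ord -[13%N]addn1 addnA addn1 expnSr. Qed.

Let half_le (a b : nat) : (b <= a)%N -> 2^-1 ^+ a <= 2^-1 ^+ b :> R.
Proof. by move=> ba; rewrite ler_wiXn2l //; lra. Qed.

Lemma union_coarse_le k j : (j <= 2 * k)%N ->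
  #|{: coarse k * bool}|%:R ^+ j * 2^-1 ^+ rounds k <= 2^-1 ^+ (k + 9) :> R.
Proof.
move=> jk; rewrite card_bins natrX -exprM.
have -> : rounds k = ((4 * k + 13) * j + ((4 * k + 13) * (2 * k - j) + (k + 9)))%N.
  have -> : rounds k = ((4 * k + 13) * (2 * k) + (k + 9))%N by rewrite /rounds; lia.
  by rewrite -{1}(subnKC jk) mulnDr -addnA.
rewrite exprD mulrA -exprMn divff ?pnatr_eq0 // expr1n mul1r.
by apply: half_le; rewrite leq_addl.
Qed.

Lemma union_single_le k :
  #|{: coarse k * bool}|%:R ^+ k * 2^-1 ^+ rounds k <= 2^-1 ^+ (k + 9) :> R.
Proof. by apply: union_coarse_le; rewrite leq_pmull. Qed.

Lemma union_pair_le k :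
  #|{: coarse k * bool}|%:R ^+ (2 * k) * 2^-1 ^+ rounds k <= 2^-1 ^+ (k + 9) :> R.
Proof. exact: union_coarse_le. Qed.

Lemma collision_coarse_le k :
  (k + 2)%:R * (2 * k + 2)%:R ^+ 2 * collprob R (fst : coarse k * bool -> coarse k) <=
  2^-1 ^+ (k + 9).
Proof.
rewrite collprob_coarse.
have k2 : (k < 2 ^ k)%N by apply: ltn_expl.
apply: (@le_trans _ _ (2 ^+ (3 * k + 3) * 2^-1 ^+ (4 * k + 12))).
  rewrite ler_wpM2r ?exprn_ge0 ?invr_ge0 // -!natrX -natrM ler_nat.
  rewrite expnD [(3 * k)%N]mulnC expnM; move: (2 ^ k)%N k2 => x k2.
  have h1 : (k + 2 <= 2 * x)%N by lia.
  have h2 : (2 * k + 2 <= 2 * x)%N by lia.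
  apply: (@leq_trans (2 * x * (2 * x) ^ 2)); last by rewrite !expnS !expn0; lia.
  by rewrite leq_mul // leq_exp2r.
have -> : (4 * k + 12 = 3 * k + 3 + (k + 9))%N by lia.
by rewrite [X in _ * X]exprD mulrA -exprMn divff ?pnatr_eq0 // expr1n mul1r.
Qed.

Lemma square_coarse_le k :
  k%:R ^+ 2 * collprob R (fst : coarse k * bool -> coarse k) <= 2^-1 ^+ (k + 9).
Proof.
apply: le_trans (collision_coarse_le k); rewrite collprob_coarse.
rewrite ler_wpM2r ?exprn_ge0 ?invr_ge0 // -!natrX -natrM ler_nat.
by apply: (@leq_trans ((2 * k + 2) ^ 2)); [rewrite leq_exp2r; lia | rewrite leq_pmull; lia].
Qed.

Lemma half_rounds_le k : 2^-1 ^+ rounds k <= 2^-1 ^+ (k + 9) :> R.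
Proof. by apply: half_le; rewrite /rounds; lia. Qed.

Lemma half9 k : 2^-1 ^+ (k + 9) = 512^-1 * 2^-1 ^+ k :> R.
Proof.
rewrite exprD mulrC; congr (_ * _).
by rewrite exprVn -natrX.
Qed.

Lemma half_le1 k : 2^-1 ^+ k <= 1 :> R.
Proof. by rewrite exprn_ile1 //; lra. Qed.

Lemma complete_error_le k :
  k%:R ^+ 2 * collprob R (fst : coarse k * bool -> coarse k) + 2^-1 ^+ rounds k <=
  256^-1 * 2^-1 ^+ k :> R.
Proof.
have := square_coarse_le k; have := half_rounds_le k; rewrite half9.
by move: (2^-1 ^+ k) => x; lra.
Qed.

Lemma reject_error_le k :
  (k + 2)%:R * (2 * k + 2)%:R ^+ 2 * collprob R (fst : coarse k * bool -> coarse k) +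
  #|{: coarse k * bool}|%:R ^+ k * 2^-1 ^+ rounds k <= 256^-1 * 2^-1 ^+ k :> R.
Proof.
have := collision_coarse_le k; have := union_single_le k; rewrite half9.
by move: (2^-1 ^+ k) => x; lra.
Qed.

Lemma iso_complete_error_le k :
  2 * (k%:R ^+ 2 * collprob R (fst : coarse k * bool -> coarse k) + 2^-1 ^+ rounds k) +
  10^-1 + 2^-1 ^+ rounds k <= 8^-1 :> R.
Proof.
have := complete_error_le k; have := half_rounds_le k; rewrite half9.
have := half_le1 k; move: (2^-1 ^+ k) => x; lra.
Qed.

Lemma iso_sound_error_le k :
  2 * (#|{: coarse k * bool}|%:R ^+ k * 2^-1 ^+ rounds k +
       k%:R ^+ 2 * collprob R (fst : coarse k * bool -> coarse k)) +
  10^-1 + #|{: coarse k * bool}|%:R ^+ (2 * k) * 2^-1 ^+ rounds k <= 8^-1 :> R.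
Proof.
have := union_single_le k; have := union_pair_le k; have := square_coarse_le k.
rewrite half9; have := half_le1 k; move: (2^-1 ^+ k) => x; lra.
Qed.

(** * Sample sizes *)

Definition jsize (k : nat) (tau : R) : nat := Num.truncn ((4 / 3) ^+ k / (20 * tau)).

Section JSize.
Variables (k : nat) (tau : R).
Hypotheses (tau0 : 0 < tau) (tau_le : tau <= 20^-1).

Let x := (4 / 3) ^+ k / (20 * tau).

Let x1 : 1 <= x.
Proof.
have t1 := tau_le.
rewrite ler_pdivlMr ?mulr_gt0 // mul1r (@le_trans _ _ 1) //; first by lra.
by rewrite exprn_ege1 //; lra.
Qed.

Let cancel43 : (4 / 3) ^+ k * (3 / 4) ^+ k = 1 :> R.
Proof. by rewrite -exprMn (_ : 4 / 3 * (3 / 4) = 1) ?expr1n //; field. Qed.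

Let xE : x * ((3 / 4) ^+ k * tau) = 20^-1.
Proof.
have -> : x * ((3 / 4) ^+ k * tau) = (4 / 3) ^+ k * (3 / 4) ^+ k * (20 * tau)^-1 * tau.
  by rewrite /x; ring.
by rewrite cancel43 mul1r invfM -mulrA mulVf ?mulr1 // gt_eqF.
Qed.

Let pow0 : 0 < (3 / 4) ^+ k * tau.
Proof. by rewrite mulr_gt0 // exprn_gt0 //; lra. Qed.

Lemma jsize_le : (jsize k tau)%:R <= x.
Proof. by rewrite truncn_le; apply: le_trans x1. Qed.

Lemma jsize_upper : (jsize k tau)%:R * ((3 / 4) ^+ k * tau) <= 20^-1.
Proof. by rewrite -xE; apply: ler_wpM2r; [exact: ltW | exact: jsize_le]. Qed.

(** As x >= 1, truncation at most halves it, so the product is at least 760 / (2 * 20) = 19. This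
    fixes the gap 3040 = 4 * 760 between accepted and rejected influences. *)
Lemma jsize_lower : 19 <= (jsize k tau)%:R * ((3 / 4) ^+ k / 4 * (3040 * tau)).
Proof.
have q1 : 1 <= (jsize k tau)%:R :> R by rewrite ler1n /jsize truncn_gt0.
have := truncnS_gt x; rewrite -/(jsize k tau) -natr1 => xq.
have : x * ((3 / 4) ^+ k * tau) <= (2 * (jsize k tau)%:R) * ((3 / 4) ^+ k * tau).
  by apply: ler_wpM2r; [exact: ltW | lra].
rewrite xE.
have -> : (jsize k tau)%:R * ((3 / 4) ^+ k / 4 * (3040 * tau)) =
  760 * ((jsize k tau)%:R * ((3 / 4) ^+ k * tau)) by field.
rewrite -mulrA; move: (_ * ((3 / 4) ^+ k * tau)) => y; lra.
Qed.

End JSize.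

Definition halfpow (k : nat) : R := 2 `^ (k%:R / 2).

Lemma halfpow_sqr k : halfpow k ^+ 2 = 2 ^+ k.
Proof.
rewrite /halfpow -powR_mulrn ?powR_ge0 // -powRrM divfK ?pnatr_eq0 //.
by rewrite powR_mulrn.
Qed.

Lemma halfpow_mono j k : (j <= k)%N -> halfpow j <= halfpow k.
Proof.
by move=> jk; rewrite /halfpow ler_powR ?ler1n // ler_wpM2r ?invr_ge0 // ler_nat.
Qed.

Lemma halfpow_ge1 k : 1 <= halfpow k.
Proof. by apply: le_trans (halfpow_mono (leq0n k)); rewrite /halfpow mul0r powRr0. Qed.

(** Compare squares: (4/3)^2 = 16/9 <= 2. This is why selecting bins with probability 3/4 stays
    within the 2^(k/2) budget. *)
Lemma pow43_le_halfpow k : (4 / 3) ^+ k <= halfpow k.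
Proof.
have Q1 := halfpow_ge1 k.
rewrite -(@ler_pXn2r _ 2) ?nnegrE ?exprn_ge0 //; [|lra|lra].
by rewrite halfpow_sqr -exprM mulnC exprM lerXn2r ?nnegrE ?exprn_ge0 //; lra.
Qed.

(** The factor 800 = 20 * 40 in the threshold is Markov's factor times the mismatch 40 beta allowed
    in the close case; twice the threshold then gives 1600 beta for the far case. *)
Definition isize (k : nat) (beta : R) : nat := (Num.truncn (halfpow k / (5 * beta))).+1.
Definition ithreshold (k : nat) (beta : R) : R :=
  800 * (isize k beta)%:R ^+ 2 * 2^-1 ^+ k * beta.

Section ISize.
Variables (k : nat) (beta : R).
Hypotheses (beta0 : 0 < beta) (beta_le : beta <= 4^-1).

Lemma isize_le : (isize k beta)%:R <= halfpow k / (5 * beta) + 1.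
Proof.
rewrite /isize -natr1 lerD2r truncn_le divr_ge0 ?mulr_ge0 ?ltW //.
exact: lt_le_trans (halfpow_ge1 k).
Qed.

Lemma isize_ge : halfpow k <= 5 * beta * (isize k beta)%:R.
Proof. by rewrite mulrC -ler_pdivrMr ?mulr_gt0 // ltW // truncnS_gt. Qed.

Lemma ithreshold_gt0 : 0 < ithreshold k beta.
Proof. by rewrite !mulr_gt0 // ?exprn_gt0 ?ltr0n // invr_gt0. Qed.

Lemma ithreshold_low : 20 * ((isize k beta)%:R ^+ 2 * (2^-1 ^+ k * (40 * beta))) <=
  ithreshold k beta.
Proof. by rewrite /ithreshold le_eqVlt; apply/orP; left; apply/eqP; ring. Qed.

Lemma ithreshold_high : 2 * ithreshold k beta <=
  (isize k beta)%:R ^+ 2 * (2^-1 ^+ k * (1600 * beta)).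
Proof. by rewrite /ithreshold le_eqVlt; apply/orP; left; apply/eqP; ring. Qed.

Lemma isize_variance : 80 * (1 + 2 * (isize k beta)%:R * 2^-1 ^+ k) <=
  (isize k beta)%:R ^+ 2 * (2^-1 ^+ k * (1600 * beta)).
Proof.
set m := (isize k beta)%:R; set y := 2^-1 ^+ k.
have y0 : 0 < y by rewrite exprn_gt0 // invr_gt0.
have m0 : 0 < m by rewrite ltr0n.
have Q1 := halfpow_ge1 k; have mQ := isize_ge; rewrite -/m in mQ.
set Q := halfpow k in Q1 mQ.
have Qy : Q ^+ 2 * y = 1.
  by rewrite halfpow_sqr -exprMn divff ?expr1n // pnatr_eq0.
have h1 : 160 * m * y <= 800 * beta * m ^+ 2 * y.
  rewrite ler_pM2r //; have := ler_wpM2r (ltW m0) (le_trans Q1 mQ); rewrite mul1r expr2; lra.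
(* With z = beta m^2 y, the relation Q^2 y = 1 gives 1 <= 25 beta z, so z >= 4/25 as beta <= 1/4,
   and 800 z >= 128. *)
have h2 : 80 <= 800 * beta * m ^+ 2 * y.
  have b0 := beta0; have b4 := beta_le; have Q0 : 0 < Q by lra.
  have : Q ^+ 2 <= (5 * beta * m) ^+ 2.
    by rewrite lerXn2r ?nnegrE ?mulr_ge0 //; apply: ltW.
  move/(ler_wpM2r (ltW y0)); rewrite Qy.
  have -> : (5 * beta * m) ^+ 2 * y = 25 * beta * (beta * m ^+ 2 * y) by ring.
  have z0 : 0 <= beta * m ^+ 2 * y by rewrite ltW // !mulr_gt0 // exprn_gt0.
  have -> : 800 * beta * m ^+ 2 * y = 800 * (beta * m ^+ 2 * y) by ring.
  move: (beta * m ^+ 2 * y) z0 => z z0; nra.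
have -> : m ^+ 2 * (y * (1600 * beta)) = 2 * (800 * beta * m ^+ 2 * y) by ring.
have -> : 80 * (1 + 2 * m * y) = 80 + 160 * m * y by ring.
lra.
Qed.

End ISize.

Lemma succn_le_ln (k : nat) (F : R) : halfpow k <= F -> k.+1%:R <= 6 * ln (F + 2).
Proof.
move=> QF; have Q1 := halfpow_ge1 k.
(* Equivalent to exp (1/2) <= 2, which follows from exp (- 1/2) >= 1 - 1/2. *)
have ln2 : 2^-1 <= ln 2 :> R.
  rewrite -[leLHS]expRK ler_ln ?posrE ?expR_gt0 //.
  have := expR_ge1Dx (- 2^-1 : R); rewrite expRN => H.
  have e0 : 0 < sequences.expR 2^-1 :> R by apply: expR_gt0.
  have := ler_wpM2l (ltW e0) H; rewrite mulfV ?gt_eqF //; lra.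
have l1 : ln 2 <= ln (F + 2) by rewrite ler_ln ?posrE; lra.
have l2 : k%:R / 2 * ln 2 <= ln (F + 2).
  by rewrite -ln_powR -/(halfpow k) ler_ln ?posrE; lra.
have k0 : 0 <= k%:R :> R by [].
rewrite -natr1; nra.
Qed.

End Constants.

(** * The tester *)

Section Tester.
Variables (R : realType) (n : nat) (gam : R).

(* tau1 is the influence of the complement of a set carrying a junta at
   distance gam; 9120 = 3 * 3040 is the loss of the junta test, and tau2 / 2 is
   the resulting distance to juntas of both inputs when they are gam-close to
   isomorphic. *)
Definition tau1 : R := 2 * gam.
Definition tau2 : R := (4 * 9120 + 2) * gam.
Definition noise : R := 9120 * tau2.

Definition stop_coins (k : nat) : finType :=
  (jcoins n (coarse k * bool)%type (rounds k) (jsize k tau1) *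
   jcoins n (coarse k * bool)%type (rounds k) (jsize k tau1))%type.

Definition final_coins (k : nat) : finType :=
  icoins n (coarse k) (rounds k) (jsize k tau2) (isize k noise).

Definition stop_stage (k : nat) (om : stop_coins k) (yes no : dtree n) : dtree n :=
  stop_tree k (fst : coarse k * bool -> coarse k) om yes no.

Definition final_stage (k : nat) (om : final_coins k) : dtree n :=
  iso_tree k (ithreshold k noise) om.

Let bins_gt0 k : (0 < #|{: coarse k * bool}|)%N.
Proof. by rewrite card_bins expn_gt0. Qed.

Lemma stop_coins_gt0 k : (0 < #|stop_coins k|)%N.
Proof.
have j0 := jcoins_gt0 n (bins_gt0 k) (rounds k) (jsize k tau1).
by rewrite card_prod muln_gt0 j0.
Qed.

Lemma final_coins_gt0 k : (0 < #|final_coins k|)%N.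
Proof.
have j0 := jcoins_gt0 n (bins_gt0 k) (rounds k) (jsize k tau2).
rewrite card_prod muln_gt0; apply/andP; split; first by rewrite card_prod muln_gt0 j0.
by apply: card_ffun_gt0; rewrite card_prod muln_gt0; apply/andP; split; apply: card_ffun_gt0;
  apply: fold_gt0.
Qed.

(** The n + 1 stages are k = 0, ..., n, a range that contains [kstar]. *)
Definition tester_coins : finType := loop_coins stop_coins final_coins n.+1 0.

Definition tester_tree : tester_coins -> dtree n :=
  @loop_tree n stop_coins final_coins stop_stage final_stage n.+1 0.

Definition tester : randalg R n :=
  uniform_alg R (loop_coins_gt0 stop_coins_gt0 final_coins_gt0 n.+1 0) tester_tree.

Variables f g : boolfun n.

Let stop k (om : stop_coins k) := jstop k (fst : coarse k * bool -> coarse k) f g om.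
Let acc k (om : final_coins k) := iaccept k (ithreshold k noise) f g om.
Let cost1 k := (4 * (rounds k * jsize k tau1))%N.
Let cost2 k := (4 * (rounds k * jsize k tau2) + 2 * (rounds k * isize k noise))%N.

Let stop_stageE k om yes no (t := if @stop k om then yes else no) :
  accepts (@stop_stage k om yes no) f g = accepts t f g /\
  queries (@stop_stage k om yes no) f g = (cost1 k + queries t f g)%N.
Proof.
exact: (@stop_treeE n k _ _ (fst : coarse k * bool -> coarse k) _ _ om yes no f g).
Qed.

Let final_stageE k om : accepts (@final_stage k om) f g = acc om /\
  queries (@final_stage k om) f g = cost2 k.
Proof. exact: iso_treeE. Qed.

Hypothesis gam0 : 0 < gam.
Hypothesis gam_small : noise <= 4^-1.

Let tau1_0 : 0 < tau1. Proof. by have h := gam0; rewrite /tau1; lra. Qed.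
Let tau2_0 : 0 < tau2. Proof. by have h := gam0; rewrite /tau2; lra. Qed.
Let tau1_le : tau1 <= 20^-1.
Proof. by have h := gam0; have := gam_small; rewrite /noise /tau2 /tau1; lra. Qed.
Let tau2_le : tau2 <= 20^-1.
Proof. by have h := gam0; have := gam_small; rewrite /noise /tau2; lra. Qed.
Let noise0 : 0 < noise. Proof. by have h := gam0; rewrite /noise /tau2; lra. Qed.

Let delta_le_noise : 3040 * tau2 <= noise.
Proof. by have h := tau2_0; rewrite /noise; lra. Qed.
Let half_tau2_le_noise : tau2 / 2 <= noise.
Proof. by have h := tau2_0; rewrite /noise; lra. Qed.
Let half_tau2 : tau2 / 2 = 3 * (3040 * tau1) + gam.
Proof. by rewrite /tau2 /tau1; field. Qed.

(** J is enlarged to exactly k variables, which does not increase the influence; one passing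
    function is enough to stop. *)
Lemma stop_complete k (J : {set 'I_n}) : (#|J| <= k <= n)%N ->
  infl R f J <= tau1 \/ infl R g J <= tau1 ->
  pr R (fun om => ~~ @stop k om) <= 128^-1 * 2^-1 ^+ k.
Proof.
move=> Jk H; have [e einj Je] := small_set_embedding Jk.
have base u : infl R u J <= tau1 -> pr R (fun om :
      jcoins n (coarse k * bool)%type (rounds k) (jsize k tau1) =>
    ~~ [exists kappa : {ffun 'I_k -> (coarse k * bool)%type}, jpass fst u om kappa]) <=
    128^-1 * 2^-1 ^+ k.
  move=> uJ.
  have ue : infl R u [set e t | t : 'I_k] <= tau1 by apply: le_trans (infl_anti R u Je) uJ.
  have := jpass_complete (fst : coarse k * bool -> coarse k) (bins_gt0 k) (rounds k)
    (jsize_upper k tau1_0 tau1_le) einj ue.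
  move/(fun h => le_trans h (complete_error_le R k)) => h.
  apply: (@le_trans _ _ (256^-1 * 2^-1 ^+ k)); last first.
    by rewrite ler_wpM2r ?exprn_ge0 ?invr_ge0 //; lra.
  apply: le_trans h; apply: le_pr => om; apply: contra => jp.
  by apply/existsP; exists [ffun t => om.1 (e t)].
have j0 := jcoins_gt0 n (bins_gt0 k) (rounds k) (jsize k tau1).
case: H => /base H; apply: le_trans H.
  rewrite -[leRHS](pr_fst R _ j0); apply: le_pr => om.
  by rewrite /stop /jstop negb_or => /andP[].
rewrite -[leRHS](pr_snd R _ j0); apply: le_pr => om.
by rewrite /stop /jstop negb_or => /andP[].
Qed.

Lemma stop_sound k :
  (forall J : {set 'I_n}, (#|J| <= k)%N -> 3 * (3040 * tau1) < infl R f J) ->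
  (forall J : {set 'I_n}, (#|J| <= k)%N -> 3 * (3040 * tau1) < infl R g J) ->
  pr R (@stop k) <= 128^-1 * 2^-1 ^+ k.
Proof.
have d0 : 0 <= 3040 * tau1 by have h := tau1_0; lra.
have j0 := jcoins_gt0 n (bins_gt0 k) (rounds k) (jsize k tau1).
pose F u (om : jcoins n (coarse k * bool)%type (rounds k) (jsize k tau1)) :=
  [exists kappa : {ffun 'I_k -> (coarse k * bool)%type}, jpass fst u om kappa].
have base u : (forall J : {set 'I_n}, (#|J| <= k)%N -> 3 * (3040 * tau1) < infl R u J) ->
    pr R (F u) <= 256^-1 * 2^-1 ^+ k.
  move=> /(jpass_reject (fst : coarse k * bool -> coarse k) (bins_gt0 k) (rounds k)
    (jsize_lower k tau1_0 tau1_le) d0) h; exact: le_trans h (reject_error_le R k).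
move=> /base Hf /base Hg.
apply: le_trans (prU R (fun om : stop_coins k => F f om.1) (fun om => F g om.2)) _.
rewrite (pr_fst R (F f) j0) (pr_snd R (F g) j0).
by move: (2^-1 ^+ k) Hf Hg => x; lra.
Qed.

(** A junta near one function is carried by the optimal permutation to the other one at the extra
    cost gam. Both inputs are then within tau2 / 2 of relabelled copies of one junta, and their
    influences are at most tau2. *)
Lemma acc_complete k (J : {set 'I_n}) : (#|J| <= k <= n)%N ->
  infl R f J <= 3 * (3040 * tau1) \/ infl R g J <= 3 * (3040 * tau1) ->
  distiso R f g <= gam -> pr R (fun om => @acc k om != true) <= 8^-1.
Proof.
move=> Jk H; have [s ->] := distiso_attained R f g => fgs.
have g0 := gam0.
have [h [h' [e [e' [HH [einj einj' hH hH' [fh gh]]]]]]] : exists (h h' : boolfun n)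
    (e e' : 'I_k -> 'I_n) (HH : cube k -> bool), [/\ injective e, injective e',
    forall x : cube n, h x = HH [ffun t => x (e t)],
    forall x : cube n, h' x = HH [ffun t => x (e' t)] &
    dist R f h <= tau2 / 2 /\ dist R g h' <= tau2 / 2].
  have [e einj Je] := small_set_embedding Jk.
  case: H => HJ.
    have [h hE fh] := infl_junta R f [set e t | t : 'I_k].
    have [HH hH] := depends_within_embedding einj hE.
    have fh2 := le_trans fh (le_trans (infl_anti R f Je) HJ).
    exists h, (relabel h s^-1%g), e, (fun t => (s^-1)%g (e t)), HH; split=> //.
    - exact: inj_comp perm_inj einj.
    - by move=> x; rewrite ffunE hH; congr HH; apply/ffunP => t; rewrite !ffunE.
    have hs : relabel (relabel h s^-1%g) s = h.
      apply/ffunP => x; rewrite !ffunE; congr (h _); apply/ffunP => i.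
      by rewrite !ffunE permKV.
    rewrite -(dist_relabel R g _ s) hs.
    rewrite half_tau2; split; first by apply: le_trans fh2 _; rewrite lerDl ltW.
    by apply: le_trans (dist_triangle R _ f h) _; rewrite addrC dist_sym lerD // dist_sym.
  have [h' hE gh] := infl_junta R g [set e t | t : 'I_k].
  have [HH hH] := depends_within_embedding einj hE.
  have gh2 := le_trans gh (le_trans (infl_anti R g Je) HJ).
  exists (relabel h' s), h', (fun t => s (e t)), e, HH; split=> //.
  - exact: inj_comp perm_inj einj.
  - by move=> x; rewrite ffunE hH; congr HH; apply/ffunP => t; rewrite !ffunE.
  rewrite half_tau2; split; last by apply: le_trans gh2 _; rewrite lerDl ltW.
  apply: le_trans (dist_triangle R f (relabel g s) (relabel h' s)) _.
  by rewrite dist_relabel addrC lerD.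
have influ u v (e0 : 'I_k -> 'I_n) : dist R u v <= tau2 / 2 ->
    depends_within [set e0 t | t : 'I_k] v -> infl R u [set e0 t | t : 'I_k] <= tau2.
  move=> uv vE; have := infl_le_dist R u v [set e0 t | t : 'I_k].
  by rewrite (infl_depends_within R vE); lra.
have If := influ f h e fh (embedding_depends_within hH).
have Ig := influ g h' e' gh (embedding_depends_within hH').
have := iaccept_complete (coarse_gt0 k) (rounds k) (jsize_upper k tau2_0 tau2_le)
  (ithreshold_gt0 k noise0) noise0 (ithreshold_low k noise) einj einj' If Ig hH hH'
  (le_trans fh half_tau2_le_noise) (le_trans gh half_tau2_le_noise).
move=> Hacc; apply: le_trans (_ : _ <= pr R (fun om => ~~ @acc k om)) _.
  by apply: le_pr => om; rewrite eqb_id.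
exact: le_trans Hacc (iso_complete_error_le R k).
Qed.

(** If f or g is far from k-juntas, the junta tests repeated inside the final test reject. Otherwise
    [iaccept_sound] applies, with 1658 = 58 + 1600. *)
Lemma acc_sound k : (k <= n)%N -> 1658 * noise < distiso R f g ->
  pr R (fun om => @acc k om != false) <= 8^-1.
Proof.
move=> kn far; have t20 := tau2_0; have d0 : 0 <= 3040 * tau2 by lra.
have k1 := half_le1 R k.
apply: le_trans (_ : _ <= pr R (@acc k)) _.
  by apply: le_pr => om; rewrite eqbF_neg negbK.
have j0 := jcoins_gt0 n (bins_gt0 k) (rounds k) (jsize k tau2).
have jj0 : (0 < #|{: jcoins n (coarse k * bool)%type (rounds k) (jsize k tau2) *
    jcoins n (coarse k * bool)%type (rounds k) (jsize k tau2)}|)%N.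
  by rewrite card_prod muln_gt0 j0.
have b0 : (0 < #|{ffun 'I_(rounds k) -> foldbatch (coarse k) (isize k noise)}|)%N.
  by have := final_coins_gt0 k; rewrite card_prod muln_gt0 => /andP[].
have base u : (forall J : {set 'I_n}, (#|J| <= k)%N -> 3 * (3040 * tau2) < infl R u J) ->
    pr R (fun om : jcoins n (coarse k * bool)%type (rounds k) (jsize k tau2) =>
      [exists kappa : {ffun 'I_k -> (coarse k * bool)%type}, jpass fst u om kappa]) <= 8^-1.
  move=> /(jpass_reject (fst : coarse k * bool -> coarse k) (bins_gt0 k) (rounds k)
    (jsize_lower k tau2_0 tau2_le) d0) h; apply: le_trans h (le_trans (reject_error_le R k) _).
  lra.
have [/existsP[Jf /andP[Jfk If]]|nf] := boolP [exists J : {set 'I_n},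
    (#|J| <= k)%N && (infl R f J <= 3 * (3040 * tau2))]; last first.
  apply: le_trans (base f _); last first.
    by move=> J Jk; move/existsPn: nf => /(_ J); rewrite Jk /= -ltNge.
  rewrite -[leRHS](pr_fst R _ j0) -[leRHS](pr_fst R _ b0).
  apply: le_pr => om /existsP[kappa /existsP[kappa' /and3P[jp _ _]]].
  by apply/existsP; exists kappa.
have [/existsP[Jg /andP[Jgk Ig]]|ng] := boolP [exists J : {set 'I_n},
    (#|J| <= k)%N && (infl R g J <= 3 * (3040 * tau2))]; last first.
  apply: le_trans (base g _); last first.
    by move=> J Jk; move/existsPn: ng => /(_ J); rewrite Jk /= -ltNge.
  rewrite -[leRHS](pr_snd R _ j0) -[leRHS](pr_fst R _ b0).
  apply: le_pr => om /existsP[kappa /existsP[kappa' /and3P[_ jp _]]].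
  by apply/existsP; exists kappa'.
have [e einj Je] := small_set_embedding (introT andP (conj Jfk kn)).
have [e' einj' Je'] := small_set_embedding (introT andP (conj Jgk kn)).
have noiseE : 3 * (3040 * tau2) = noise by rewrite /noise; ring.
have If' : infl R f [set e t | t : 'I_k] <= noise.
  by rewrite -noiseE; apply: le_trans (infl_anti R f Je) If.
have Ig' : infl R g [set e' t | t : 'I_k] <= noise.
  by rewrite -noiseE; apply: le_trans (infl_anti R g Je') Ig.
have [h hE fh] := infl_junta R f [set e t | t : 'I_k].
have [h' hE' gh] := infl_junta R g [set e' t | t : 'I_k].
have fars s : 58 * noise + 1600 * noise < dist R f (relabel g s).
  apply: lt_le_trans (distiso_le R f g s); rewrite (_ : _ + _ = 1658 * noise) //; ring.
have := iaccept_sound (coarse_gt0 k) (rounds k) (jsize_lower k tau2_0 tau2_le)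
  (ithreshold_gt0 k noise0) noise0 (ithreshold_high k noise)
  (isize_variance k noise0 gam_small) kn einj einj' delta_le_noise If' Ig' hE hE'
  (le_trans fh If') (le_trans gh Ig') fars.
by move=> h0; apply: le_trans h0 (iso_sound_error_le R k).
Qed.

(** For far inputs the final test is reliable at every stage. For close inputs it is reliable as
    soon as one function is near a j-junta, and stages where neither is near one rarely stop. The
    total error is at most 1/8 + 2/128. *)
Lemma tester_error (b : bool) ks (J : {set 'I_n}) : (#|J| <= ks <= n)%N ->
  infl R f J <= tau1 \/ infl R g J <= tau1 ->
  (if b then distiso R f g <= gam else 1658 * noise < distiso R f g) ->
  2 / 3 <= Prob tester (fun t => accepts t f g == b).
Proof.
move=> Jk IJ Hb; have t10 := tau1_0.
have ksn : (ks <= n)%N by case/andP: Jk.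
rewrite Prob_uniform.
suff : pr R (fun om => accepts (tester_tree om) f g != b) <= 8^-1 + 2 * (128^-1 * 2^-1 ^+ 0).
  rewrite (@prC _ _ (fun om => accepts (tester_tree om) f g == b)).
    by rewrite expr0; lra.
  exact: loop_coins_gt0 stop_coins_gt0 final_coins_gt0 n.+1 0.
apply: (loop_error stop_coins_gt0 final_coins_gt0 stop_stageE final_stageE (ks := ks)) => //.
- by rewrite invr_ge0.
- by rewrite invr_ge0.
- exact: stop_complete Jk IJ.
- case: b Hb => Hb; last exact: acc_sound.
  by apply: (acc_complete Jk) => //; case: IJ => IJ; [left|right]; lra.
move=> j jks; have jn : (j <= n)%N by rewrite (leq_trans (ltnW jks)).
case: b Hb => Hb; last by left; apply: acc_sound.
have [/existsP[J' /andP[J'j IJ']]|nJ] := boolP [exists J' : {set 'I_n}, (#|J'| <= j)%N &&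
    ((infl R f J' <= 3 * (3040 * tau1)) || (infl R g J' <= 3 * (3040 * tau1)))].
  by left; apply: (@acc_complete j J') => //; [rewrite J'j | apply/orP].
right; apply: stop_sound => J' J'j; move/existsPn: nJ => /(_ J');
  by rewrite J'j /= negb_or -!ltNge => /andP[].
Qed.

Lemma stage_cost k : (cost1 k + cost2 k)%:R <= 81 * k.+1%:R ^+ 2 * (halfpow R k / gam).
Proof.
have g0 := gam0; have Q1 := halfpow_ge1 R k; have t10 := tau1_0; have t20 := tau2_0.
have n0 := noise0; have n4 := gam_small.
set X := halfpow R k / gam.
have X1 : 1 <= X.
  by rewrite ler_pdivlMr // mul1r; move: n4; rewrite /noise /tau2; lra.
have jX tau : 0 < tau -> tau <= 20^-1 -> 2 * gam <= tau -> (jsize k tau)%:R <= X / 40.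
  move=> ta tb tc; apply: le_trans (jsize_le k ta tb) _.
  rewrite -mulrA -invfM; apply: ler_pM;
    rewrite ?exprn_ge0 ?divr_ge0 ?invr_ge0 ?mulr_ge0 ?(ltW ta) //.
  - exact: pow43_le_halfpow.
  - by rewrite lef_pV2 ?posrE ?mulr_gt0 //; lra.
have iX : (isize k noise)%:R <= X / 5 + 1.
  apply: le_trans (isize_le k n0) _; rewrite lerD2r -mulrA -invfM.
  have le5 : gam * 5 <= 5 * noise by rewrite /noise /tau2; lra.
  have p5 : 0 < gam * 5 by rewrite mulr_gt0.
  by rewrite ler_wpM2l ?(le_trans _ Q1) // lef_pV2 // posrE ?p5 // (lt_le_trans p5).
have j1 := jX tau1 t10 tau1_le (lexx _).
have j2 : (jsize k tau2)%:R <= X / 40 by apply: jX tau2_le _; rewrite // /tau2; lra.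
have rk : (rounds k)%:R <= 27 * k.+1%:R ^+ 2 :> R.
  by rewrite -natrX -natrM ler_nat rounds_le.
have r0 : 0 <= (rounds k)%:R :> R by [].
have -> : (cost1 k + cost2 k)%:R = (rounds k)%:R * (4 * (jsize k tau1)%:R +
    4 * (jsize k tau2)%:R + 2 * (isize k noise)%:R) :> R.
  by rewrite -!natrM -!natrD -natrM cost_factor.
(* The sum is at most 4 X/40 + 4 X/40 + 2 (X/5 + 1), which is below 3 X since X >= 1. *)
apply: (@le_trans _ _ ((rounds k)%:R * (3 * X))); first by rewrite ler_wpM2l //; lra.
have -> : 81 * k.+1%:R ^+ 2 * X = 27 * k.+1%:R ^+ 2 * (3 * X) by ring.
by rewrite ler_wpM2r //; lra.
Qed.

Lemma total_cost k : (\sum_(0 <= j < k.+1) (cost1 j + cost2 j))%:R <=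
  81 * k.+1%:R ^+ 3 * (halfpow R k / gam).
Proof.
have g0 := gam0.
rewrite natr_sum big_mkord.
apply: (@le_trans _ _ (\sum_(j < k.+1) 81 * k.+1%:R ^+ 2 * (halfpow R k / gam))).
  apply: ler_sum => j _; apply: le_trans (stage_cost j) _.
  have jk : (j.+1 <= k.+1)%N by [].
  apply: ler_pM.
  - by rewrite mulr_ge0 // exprn_ge0.
  - by rewrite divr_ge0 ?powR_ge0 // ltW.
  - by rewrite ler_wpM2l // lerXn2r ?nnegrE // ler_nat.
  by rewrite ler_wpM2r ?invr_ge0 ?(ltW g0) // halfpow_mono.
by rewrite sum_ord_const le_eqVlt; apply/orP; left; apply/eqP; ring.
Qed.

Lemma tester_queries om :
  (queries (tester_tree om) f g)%:R <= 81 * n.+1%:R ^+ 3 * (halfpow R n / gam).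
Proof.
apply: le_trans (total_cost n); rewrite ler_nat.
exact: (loop_queries stop_stageE final_stageE).
Qed.

Lemma tester_queries_pr ks (J : {set 'I_n}) : (#|J| <= ks <= n)%N ->
  infl R f J <= tau1 \/ infl R g J <= tau1 ->
  2 / 3 <= Prob tester (fun t => (queries t f g)%:R <=
    81 * ks.+1%:R ^+ 3 * (halfpow R ks / gam)).
Proof.
move=> Jk IJ; have ksn : (ks <= n)%N by case/andP: Jk.
rewrite Prob_uniform.
apply: (@le_trans _ _ (pr R (fun om => (queries (tester_tree om) f g <=
    \sum_(0 <= j < ks.+1) (cost1 j + cost2 j))%N))); last first.
  by apply: le_pr => om H; apply: le_trans (total_cost ks); rewrite ler_nat.
have := loop_queries_pr R stop_coins_gt0 final_coins_gt0 stop_stageE final_stageE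
  (_ : (0 <= ks < 0 + n.+1)%N).
move=> /(_ ksn)/le_trans/(_ (stop_complete Jk IJ)).
rewrite (@prC _ _ (fun om : tester_coins => (queries (tester_tree om) f g <=
    \sum_(0 <= j < ks.+1) (cost1 j + cost2 j))%N)); last first.
  exact: loop_coins_gt0 stop_coins_gt0 final_coins_gt0 n.+1 0.
have := half_le1 R ks; move: (2^-1 ^+ ks) => x; lra.
Qed.

End Tester.

Theorem theorem1p3 (R : realType) :
  exists (C K : R) (c : nat) (A : forall n : nat, R -> randalg R n),
    1 <= C /\
    forall (n : nat) (eps : R) (f g : boolfun n), 0 < eps -> eps < 1 ->
      [/\ close_to_iso (eps / C) f g ->
            2 / 3 <= Prob (A n eps) (fun t => accepts t f g),
          far_from_iso eps f g ->
            2 / 3 <= Prob (A n eps) (fun t => ~~ accepts t f g),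
          2 / 3 <= Prob (A n eps) (fun t => (queries t f g)%:R <=
            softO K c (2 `^ ((kstar f g (eps / C))%:R / 2) / eps))
        & forall w : coins (A n eps),
            (queries (strategy w) f g)%:R <=
            softO K c (2 `^ (n%:R / 2) / eps)].
Proof.
(* Chosen so that 1658 * noise (eps / C) = eps, the distance required by [acc_sound]. *)
pose C : R := 1658 * (9120 * (4 * 9120 + 2)).
have C0 : 0 < C by rewrite /C; lra.
(* 17496 = 81 * 6^3: the factor (k + 1)^3 of [total_cost] is bounded by (6 ln (F + 2))^3. *)
exists C, (17496 * C), 3, (fun n eps => tester n (eps / C)); split.
  by rewrite /C; lra.
move=> n eps f g eps0 eps1; set gam := eps / C.
have gam0 : 0 < gam by rewrite divr_gt0.
have noiseE : 1658 * noise gam = eps.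
  have -> : 1658 * noise gam = C * gam by rewrite /noise /tau2 /C; ring.
  by rewrite /gam mulrC divfK // gt_eqF.
have gam_small : noise gam <= 4^-1 by move: noiseE eps1; clear; move: (noise gam) => x; lra.
have [ks_close _] := kstarP f g (ltW gam0).
have ksn : (kstar f g gam <= n)%N by rewrite /kstar -ltnS ltn_ord.
set ks := kstar f g gam in ks_close ksn *.
(* J is the set of variables of a junta within gam of f or g; by [infl_le_dist] the influence
   outside it is at most 2 gam = [tau1]. *)
have [J Jk IJ] : exists2 J : {set 'I_n}, (#|J| <= ks <= n)%N &
    infl R f J <= tau1 gam \/ infl R g J <= tau1 gam.
  have base (u h : boolfun n) : dist R u h <= gam -> infl R u [set i | depends_on h i] <= tau1 gam.
    move=> uh; have := infl_le_dist R u h [set i | depends_on h i].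
    rewrite (infl_depends_within R (@depends_on_within n h)) add0r => H.
    by apply: le_trans H _; rewrite /tau1 ler_pM2l.
  case/orP: ks_close => /existsP[h /andP[hj uh]]; exists [set i | depends_on h i].
  - by rewrite ksn andbT.
  - by left; apply: base.
  - by rewrite ksn andbT.
  - by right; apply: base.
have cost (k : nat) : 81 * k.+1%:R ^+ 3 * (halfpow R k / gam) <=
    softO (17496 * C) 3 (2 `^ (k%:R / 2) / eps).
  rewrite /softO -/(halfpow R k).
  have Q1 := halfpow_ge1 R k.
  have -> : halfpow R k / gam = C * (halfpow R k / eps).
    by rewrite /gam invf_div; ring.
  set F := halfpow R k / eps.
  have QF : halfpow R k <= F.
    by rewrite /F ler_pdivlMr // ler_piMr ?(le_trans _ Q1) // ltW.
  have F0 : 0 <= F by apply: le_trans QF; apply: le_trans Q1.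
  have kln := succn_le_ln QF; set l := ln (F + 2) in kln *.
  have k3 : k.+1%:R ^+ 3 <= (6 * l) ^+ 3.
    by rewrite lerXn2r ?nnegrE // (le_trans _ kln).
  have -> : 17496 * C * (F * l ^+ 3) = 81 * (6 * l) ^+ 3 * (C * F) by ring.
  by apply: ler_wpM2r; [rewrite mulr_ge0 ?(ltW C0) | rewrite ler_wpM2l].
split.
- move=> H; have := tester_error gam0 gam_small (b := true) Jk IJ H.
  by rewrite /Prob; under eq_bigl do rewrite eqb_id.
- rewrite /far_from_iso -noiseE => H.
  have := tester_error gam0 gam_small (b := false) Jk IJ H.
  by rewrite /Prob; under eq_bigl do rewrite eqbF_neg.
- apply: le_trans (tester_queries_pr gam0 gam_small Jk IJ) _.
  rewrite !Prob_uniform; apply: le_pr => om H; exact: le_trans H (cost ks).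
move=> w; exact: le_trans (tester_queries f g gam0 gam_small w) (cost n).
Qed.
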